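(* Let $f\not\equiv 0$ be a weakly holomorphic modular function for $\mathrm{SL}(2,\mathbb{Z})$ such that $f(e^{it})$ is real and non-negative for all $t\in[\pi/3,2\pi/3]$. Let $\phi=[\overline{1;1}]=\frac{1+\sqrt5}2$ and $\psi=[\overline{2;2}]=1+\sqrt2$. For every Markov irrationality $w\in\mathcal{M}$ we have $\Lambda_f(w)\in[\Lambda_f(\psi),\Lambda_f(\phi)]$.
   Context: Let $T=\begin{pmatrix}1&1\\0&1\end{pmatrix}$, $V=\begin{pmatrix}1&0\\1&1\end{pmatrix}$. For hyperbolic $A\in\mathrm{SL}(2,\mathbb{Z})$ with repelling/attracting fixed points $w,\tilde w$, let $Q(x,y)=ax^2+bxy+cy^2$ be the primitive integral form vanishing at $(w,1),(\tilde w,1)$ with $\mathrm{sgn}(a)=\mathrm{sgn}(w-\tilde w)$, $D=b^2-4ac$, and $I_f(A)=\int_{\tau_0}^{A\tau_0}\frac{f(\tau)\sqrt D}{Q(\tau,1)}d\tau$ ($\tau_0\in\mathbb{H}$ arbitrary), $I_f(A)=0$ for non-hyperbolic $A$. For irrational $x=[a_1;a_2,\ldots]>0$ let $A_n$ be the product of the first $n$ letters of the infinite word $T^{a_1}V^{a_2}T^{a_3}V^{a_4}\cdots$, and $\Lambda_f(x)=\limsup_n\mathrm{Re}(I_f(A_n))/n$. Markov irrationalities: for real quadratic irrationals with purely periodic continued fractions $u=[\overline{a_1;\ldots,a_r}]$, $v=[\overline{b_1;\ldots,b_s}]$ written with minimal even period lengths $r,s$, set $u\odot v=[\overline{a_1;\ldots,a_r,b_1,\ldots,b_s}]$.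 Two fractions $a/b<c/d$ in $[0,1/2]$ (in lowest terms) are neighbors if $bc-ad=1$; their mediant is $a/b\oplus c/d=(a+c)/(b+d)$; every rational in $(0,1/2)$ is the mediant of a unique pair of neighbors. Define $w:[0,1/2]\cap\mathbb{Q}\to\mathbb{R}$ recursively by $w(0/1)=[\overline{1;1}]$, $w(1/2)=[\overline{2;2}]$ and $w(a/b\oplus c/d)=w(c/d)\odot w(a/b)$ for neighbors $a/b<c/d$. The set of Markov irrationalities is $\mathcal{M}=w([0,1/2]\cap\mathbb{Q})$. *)

(* Defs.v *)
From Stdlib Require Import Reals ZArith List ClassicalEpsilon.
From Coquelicot Require Import Coquelicot.
Import ListNotations.

Open Scope R_scope.

Definition ZtoC (z : Z) : C := RtoC (IZR z).

Record mat2 : Type := Mat { m11 : Z; m12 : Z; m21 : Z; m22 : Z }.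

Definition mat_mul (A B : mat2) : mat2 :=
  Mat (m11 A * m11 B + m12 A * m21 B) (m11 A * m12 B + m12 A * m22 B)
      (m21 A * m11 B + m22 A * m21 B) (m21 A * m12 B + m22 A * m22 B).

Definition mat_id : mat2 := Mat 1 0 0 1.
Definition mat_T : mat2 := Mat 1 1 0 1.
Definition mat_V : mat2 := Mat 1 0 1 1.

Definition mat_det (A : mat2) : Z := (m11 A * m22 A - m12 A * m21 A)%Z.

Definition hyperbolic (A : mat2) : Prop := (2 < Z.abs (m11 A + m22 A))%Z.

Definition upper_half (tau : C) : Prop := 0 < Im tau.

Definition moebC (A : mat2) (z : C) : C :=
  ((ZtoC (m11 A) * z + ZtoC (m12 A)) / (ZtoC (m21 A) * z + ZtoC (m22 A)))%C.

Definition moebR (A : mat2) (x : R) : R :=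
  (IZR (m11 A) * x + IZR (m12 A)) / (IZR (m21 A) * x + IZR (m22 A)).

(* A hyperbolic element of SL(2,Z) does not fix infinity, so real fixed points
   suffice. *)
Definition fixed_point (A : mat2) (x : R) : Prop :=
  IZR (m21 A) * x + IZR (m22 A) <> 0 /\ moebR A x = x.

Definition attracting_fixed_point (A : mat2) (x : R) : Prop :=
  fixed_point A x /\ Rabs (Derive (moebR A) x) < 1.

Definition repelling_fixed_point (A : mat2) (x : R) : Prop :=
  fixed_point A x /\ 1 < Rabs (Derive (moebR A) x).

Record form : Type := Form { fa : Z; fb : Z; fc : Z }.

Definition form_evalR (Q : form) (x y : R) : R :=
  IZR (fa Q) * x ^ 2 + IZR (fb Q) * x * y + IZR (fc Q) * y ^ 2.

Definition form_evalC (Q : form) (x y : C) : C :=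
  (ZtoC (fa Q) * x ^ 2 + ZtoC (fb Q) * x * y + ZtoC (fc Q) * y ^ 2)%C.

Definition form_disc (Q : form) : Z := (fb Q ^ 2 - 4 * fa Q * fc Q)%Z.

Definition form_primitive (Q : form) : Prop :=
  Z.gcd (fa Q) (Z.gcd (fb Q) (fc Q)) = 1%Z.

Definition is_form_of (A : mat2) (Q : form) : Prop :=
  form_primitive Q /\
  exists w w' : R,
    repelling_fixed_point A w /\ attracting_fixed_point A w' /\
    form_evalR Q w 1 = 0 /\ form_evalR Q w' 1 = 0 /\
    sign (IZR (fa Q)) = sign (w - w').

(* For hyperbolic A in SL(2,Z) there is exactly one Q with [is_form_of A Q];
   for other A the value is irrelevant. *)
Definition form_of (A : mat2) : form :=
  epsilon (inhabits (Form 0 0 0)) (is_form_of A).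

Definition segment (z1 z2 : C) (t : R) : C := (z1 + RtoC t * (z2 - z1))%C.

Definition segment_integral (g : C -> C) (z1 z2 : C) : C :=
  RInt (V := C_R_CompleteNormedModule)
       (fun t : R => (g (segment z1 z2 t) * (z2 - z1))%C) 0 1.

(* The integrand is holomorphic on the upper half-plane, which is convex, so
   the segment from tau0 to A tau0 represents any path. *)
Definition cycle_integral (f : C -> C) (tau0 : C) (A : mat2) : C :=
  if excluded_middle_informative (hyperbolic A) then
    let Q := form_of A in
    segment_integral
      (fun tau => (f tau * RtoC (sqrt (IZR (form_disc Q)))
                   / form_evalC Q tau 1)%C)
      tau0 (moebC A tau0)
  else RtoC 0.

(* q = exp (2 i pi tau) *)
Definition qexp (tau : C) : C :=
  (exp (- 2 * PI * Im tau) * cos (2 * PI * Re tau),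
   exp (- 2 * PI * Im tau) * sin (2 * PI * Re tau)).

Definition holomorphic_on_H (f : C -> C) : Prop :=
  forall tau : C, upper_half tau ->
    ex_derive (K := C_AbsRing) (V := C_NormedModule) f tau.

Definition SL2Z_invariant (f : C -> C) : Prop :=
  forall (A : mat2) (tau : C),
    mat_det A = 1%Z -> upper_half tau -> f (moebC A tau) = f tau.

(* Fourier expansion f = sum_{n >= 0} c_n q^(n-N), with at most a pole at the
   cusp; it converges on all of H because f is holomorphic there. *)
Definition meromorphic_at_cusp (f : C -> C) : Prop :=
  exists (N : nat) (c : nat -> C), forall tau : C, upper_half tau ->
    is_series (K := C_AbsRing) (V := C_NormedModule)
      (fun n : nat => (c n * qexp tau ^ n / qexp tau ^ N)%C) (f tau).

(* Only the values of f on the upper half-plane matter. *)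
Definition weakly_holomorphic_modular_function (f : C -> C) : Prop :=
  holomorphic_on_H f /\ SL2Z_invariant f /\ meromorphic_at_cusp f.

Definition irrational (x : R) : Prop :=
  forall p q : Z, q <> 0%Z -> x <> IZR p / IZR q.

(* Indices start at 0: for irrational x = [a_1; a_2, ...],
   [cf_digit x n] is a_(n+1). *)
Fixpoint cf_tail (x : R) (n : nat) : R :=
  match n with
  | O => x
  | S m => / (cf_tail x m - IZR (Zfloor (cf_tail x m)))
  end.

Definition cf_digit (x : R) (n : nat) : Z := Zfloor (cf_tail x n).

(* The first k blocks of the word T^(a_1) V^(a_2) T^(a_3) V^(a_4) ... *)
Definition cf_word (x : R) (k : nat) : list mat2 :=
  flat_map
    (fun i => repeat (if Nat.even i then mat_T else mat_V)
                     (Z.to_nat (cf_digit x i)))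
    (seq 0 k).

(* Only a_1 can vanish when x > 0 is irrational, so n+1 blocks contain at least
   n letters. *)
Definition cf_matrix (x : R) (n : nat) : mat2 :=
  fold_right mat_mul mat_id (firstn n (cf_word x (S n))).

Definition Lambda (f : C -> C) (tau0 : C) (x : R) : Rbar :=
  LimSup_seq (fun n => Re (cycle_integral f tau0 (cf_matrix x n)) / INR n).

Definition purely_periodic (l : list Z) (x : R) : Prop :=
  l <> [] /\ List.Forall (fun a => (1 <= a)%Z) l /\ irrational x /\
  forall n : nat, cf_digit x n = nth (n mod length l) l 0%Z.

Definition minimal_even_period (l : list Z) (x : R) : Prop :=
  purely_periodic l x /\ Nat.Even (length l) /\
  forall l' : list Z, purely_periodic l' x -> Nat.Even (length l') ->
    (length l <= length l')%nat.

Definition is_conjunction (u v z : R) : Prop :=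
  exists l m : list Z,
    minimal_even_period l u /\ minimal_even_period m v /\
    purely_periodic (l ++ m) z.

Definition phi : R := (1 + sqrt 5) / 2.
Definition psi : R := 1 + sqrt 2.

(* [neighbors a b c d] is about the fractions a/b < c/d in [0,1/2]; the
   determinant condition forces lowest terms. *)
Definition neighbors (a b c d : Z) : Prop :=
  (0 <= a /\ 0 < b /\ 0 < d /\ 2 * c <= d /\ b * c - a * d = 1)%Z.

(* Graph of the recursive map w: [markov_map a b x] is w(a/b) = x, with a/b in
   lowest terms. It is the graph of a function since each rational in (0,1/2)
   is the mediant of a unique pair of neighbors. *)
Inductive markov_map : Z -> Z -> R -> Prop :=
| markov_zero : markov_map 0 1 phi
| markov_half : markov_map 1 2 psi
| markov_mediant (a b c d : Z) (x y z : R) :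
    neighbors a b c d ->
    markov_map a b x -> markov_map c d y ->
    is_conjunction y x z ->
    markov_map (a + c) (b + d) z.

Definition markov_irrationality (x : R) : Prop :=
  exists a b : Z, markov_map a b x.

(* Main.v *)
(* On the hyperbolic axis of a word A in T and V with repelling fixed point -y < 0
   and attracting fixed point x > 0, the cycle integral is the integral of
   f(tau) (1/(tau+y) - 1/(tau-x)) from tau0 to A tau0. Holomorphic functions on the
   upper half-plane have primitives (Goursat), so the base point may be moved to
   rho2 = exp(2 pi i/3). As T rho2 = V rho2 = exp(pi i/3), modular invariance turns
   each letter into an integral over one and the same arc of the unit circle, against
   the positive kernel sin t (k_{cos t}(x_j) + k_{-cos t}(y_j)) with
   k_c(x) = x/(x^2+1-2cx), where the x_j and y_j run through the orbits of x and y
   along the word. By contraction, Lambda of a purely periodic continued fraction is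
   the average over one period. Markov irrationalities have periods made of the
   blocks 1,1 and 2,2, whose orbits stay in [phi, psi]; there a blockwise inequality,
   corrected by a telescoping potential (X/4 for the upper and -1/X for the lower
   bound, up to positive factors), compares the average of k_c with its values along
   the periods of phi and psi. *)

Require Import Defs.
From Stdlib Require Import Reals Lra Lia ClassicalEpsilon List ZArith.
From Coquelicot Require Import Coquelicot.
Import ListNotations.
Open Scope R_scope.

(** * Complex derivatives and segment integrals *)

(** The axis of [A_n] changes with [n], so the fixed points of a prefix are controlled only by
    bounds uniform in the starting point: by contraction, the sum over [k] periods exceeds [k] times
    the periodic value by at most a constant. A one-sided bound is enough for the limit superior,
    because at multiples of the period the axis is that of the period itself and the quotient is
    exactly the average. The repelling orbit needs no estimate of its own. Reversing a block
    [T^a V^a] exchanges T and V, this exchange is conjugation by x -> 1/x, and k_c is invariant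
    under inversion since 1/k_c(x) = x + 1/x - 2c. A potential is unavoidable: away from its fixed
    point, the short block violates the plain upper bound, and the long block the plain lower bound,
    to first order. The other block has slack of fixed size. A coefficient of the potential must
    therefore be large enough to pay the first-order defect of one block and small enough for the
    slack of the other, uniformly in 2c between -1 and 1. *)

Notation is_Cderive := (is_derive (K := C_AbsRing) (V := C_NormedModule)).

Lemma Cplus_sub (a b : C) : (a + (b - a))%C = b.
Proof. ring. Qed.

(** Increments measured by [Cmod] replace filters in all the hands-on derivative estimates below. *)
Lemma is_Cderive_eps (f : C -> C) (z l : C) :
  is_Cderive f z l <->
  forall eps, 0 < eps -> exists delta, 0 < delta /\
    forall h, Cmod h < delta -> Cmod (f (z + h) - f z - h * l)%C <= eps * Cmod h.
Proof.
  split.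
  - intros [_ H] eps Heps.
    specialize (H z (fun P HP => HP) (mkposreal eps Heps)).
    destruct H as [d Hd].
    exists d; split; [apply cond_pos|].
    intros h Hh.
    specialize (Hd (z + h)%C).
    assert (E : (z + h - z)%C = h) by ring.
    assert (B : Cmod (z + h - z)%C < d) by (rewrite E; exact Hh).
    specialize (Hd B).
    change (Cmod (f (z + h) - f z - (z + h - z) * l)%C <= eps * Cmod (z + h - z)%C) in Hd.
    rewrite E in Hd. exact Hd.
  - intros H; split.
    + apply is_linear_scal_l.
    + intros x Hx eps.
      apply (is_filter_lim_locally_unique (K := C_AbsRing) (V := AbsRing_NormedModule C_AbsRing)) in Hx.
      change (z = x) in Hx. subst x.
      destruct (H eps (cond_pos eps)) as [d [Hd Hd']].
      exists (mkposreal d Hd). intros y Hy.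
      change (Cmod (y - z)%C < d) in Hy.
      change (Cmod (f y - f z - (y - z) * l)%C <= eps * Cmod (y - z)%C).
      specialize (Hd' _ Hy).
      rewrite (Cplus_sub z y) in Hd'.
      exact Hd'.
Qed.

Lemma norm_C_R (z : C) : norm (V := C_R_NormedModule) z = Cmod z.
Proof. symmetry. exact (Cmod_norm z). Qed.

(** Common ground between complex differentiability at a point and continuity of curves from the
    reals into [C_R_NormedModule]. *)
Definition Ccont (g : C -> C) (z : C) : Prop :=
  forall eps, 0 < eps -> exists delta, 0 < delta /\
    forall h, Cmod h < delta -> Cmod (g (z + h) - g z)%C < eps.

Lemma is_Cderive_cont (f : C -> C) (z l : C) : is_Cderive f z l -> Ccont f z.
Proof.
  intros H eps He. assert (H0 := proj1 (is_Cderive_eps _ _ _) H); clear H; rename H0 into H.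
  destruct (H 1 Rlt_0_1) as [d [Hd H1]].
  assert (Hl : 0 < 1 + Cmod l) by (pose proof (Cmod_ge_0 l); lra).
  exists (Rmin d (eps / (1 + Cmod l))). split.
  - apply Rmin_pos; auto. apply Rdiv_lt_0_compat; auto.
  - intros h Hh.
    assert (h1 := Rlt_le_trans _ _ _ Hh (Rmin_l _ _)).
    assert (h2 := Rlt_le_trans _ _ _ Hh (Rmin_r _ _)).
    specialize (H1 h h1).
    replace (f (z + h) - f z)%C with ((f (z + h) - f z - h * l) + h * l)%C by ring.
    eapply Rle_lt_trans; [apply Cmod_triangle|]. rewrite Cmod_mult.
    apply (Rmult_lt_compat_r _ _ _ Hl) in h2.
    unfold Rdiv in h2. rewrite Rmult_assoc, Rinv_l in h2 by lra. nra.
Qed.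

Lemma continuous_curve_eps (p : R -> C) (t : R) :
  continuous (U := C_R_NormedModule) p t <->
  forall eps, 0 < eps -> exists delta, 0 < delta /\
    forall s, Rabs (s - t) < delta -> Cmod (p s - p t)%C < eps.
Proof.
  split.
  - intros H eps He.
    destruct (proj1 (filterlim_locally_ball_norm (K := R_AbsRing) (U := C_R_NormedModule)
      p (p t)) H (mkposreal eps He)) as [d Hd].
    exists d. split; [apply cond_pos|]. intros s Hs.
    specialize (Hd s Hs). unfold ball_norm in Hd. rewrite norm_C_R in Hd. exact Hd.
  - intros H. apply (filterlim_locally_ball_norm (K := R_AbsRing) (U := C_R_NormedModule)).
    intros eps. destruct (H eps (cond_pos eps)) as [d [Hd H1]].
    exists (mkposreal d Hd). intros s Hs. unfold ball_norm. rewrite norm_C_R.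
    exact (H1 s Hs).
Qed.

Lemma Ccont_curve (g : C -> C) (p : R -> C) (t : R) :
  Ccont g (p t) -> continuous (U := C_R_NormedModule) p t ->
  continuous (U := C_R_NormedModule) (fun s => g (p s)) t.
Proof.
  rewrite !continuous_curve_eps. intros Hg Hp eps He.
  destruct (Hg eps He) as [d [Hd H]].
  destruct (Hp d Hd) as [d' [Hd' H']].
  exists d'. split; auto. intros s Hs.
  specialize (H _ (H' s Hs)). rewrite Cplus_sub in H. exact H.
Qed.

Definition Ccont_seg (g : C -> C) (a b : C) : Prop :=
  forall t, 0 <= t <= 1 -> Ccont g (segment a b t).

Lemma segment_continuous (a b : C) (t : R) :
  continuous (U := C_R_NormedModule) (segment a b) t.
Proof.
  unfold segment.
  apply (continuous_comp_2 (fun t => a) (fun t => RtoC t * (b - a))%C (fun x y : C_R_NormedModule => plus x y)).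
  apply continuous_const.
  apply (continuous_ext (fun t : R => scal t ((b - a)%C : C_R_NormedModule))).
  intros x. unfold scal; simpl; unfold prod_scal; simpl. unfold scal; simpl; unfold mult; simpl.
  apply injective_projections; simpl; ring.
  apply (continuous_scal (V := C_R_NormedModule)).
  apply continuous_id. apply continuous_const.
  apply continuous_plus; [apply continuous_fst|apply continuous_snd].
Qed.

Lemma continuous_Cmult_r (p : R -> C) (k : C) t :
  continuous (U := C_R_NormedModule) p t ->
  continuous (U := C_R_NormedModule) (fun s => (p s * k)%C) t.
Proof.
  rewrite !continuous_curve_eps. intros H eps He.
  assert (Hk : 0 < 1 + Cmod k) by (pose proof (Cmod_ge_0 k); lra).
  destruct (H (eps / (1 + Cmod k))) as [d [Hd H1]]; [apply Rdiv_lt_0_compat; auto|].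
  exists d. split; auto. intros s Hs. specialize (H1 s Hs).
  replace (p s * k - p t * k)%C with ((p s - p t) * k)%C by ring.
  rewrite Cmod_mult. apply (Rmult_lt_compat_r _ _ _ Hk) in H1.
  unfold Rdiv in H1. rewrite Rmult_assoc, Rinv_l in H1 by lra.
  pose proof (Cmod_ge_0 (p s - p t)%C). lra.
Qed.

Lemma segment_integral_is_RInt (g : C -> C) (a b : C) : Ccont_seg g a b ->
  is_RInt (V := C_R_CompleteNormedModule)
       (fun t : R => (g (segment a b t) * (b - a))%C) 0 1 (segment_integral g a b).
Proof.
  intros H. apply (RInt_correct (V := C_R_CompleteNormedModule)).
  apply ex_RInt_continuous. rewrite Rmin_left, Rmax_right by lra.
  intros t Ht. apply continuous_Cmult_r. apply Ccont_curve. now apply H.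
  apply segment_continuous.
Qed.

Lemma segment_integral_bound (g : C -> C) (a b : C) M : Ccont_seg g a b ->
  (forall t, 0 <= t <= 1 -> Cmod (g (segment a b t)) <= M) ->
  Cmod (segment_integral g a b) <= M * Cmod (b - a).
Proof.
  intros H HM. rewrite <- norm_C_R.
  replace (M * Cmod (b - a)) with ((1 - 0) * (M * Cmod (b - a))) by ring.
  eapply (norm_RInt_le_const (V := C_R_NormedModule)); [lra| |apply segment_integral_is_RInt; auto].
  intros t Ht. rewrite norm_C_R, Cmod_mult.
  apply Rmult_le_compat_r; [apply Cmod_ge_0|auto].
Qed.

Lemma segment_integral_plus (g1 g2 : C -> C) (a b : C) : Ccont_seg g1 a b -> Ccont_seg g2 a b ->
  segment_integral (fun z => g1 z + g2 z)%C a b = (segment_integral g1 a b + segment_integral g2 a b)%C.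
Proof.
  intros H1 H2. unfold segment_integral at 1.
  apply (is_RInt_unique (V := C_R_CompleteNormedModule)).
  eapply is_RInt_ext; [|apply (is_RInt_plus (V := C_R_NormedModule)); apply segment_integral_is_RInt; eassumption].
  intros t _. simpl. unfold plus; simpl. unfold prod_plus, plus; simpl.
  apply injective_projections; simpl; ring.
Qed.

(** The signed length [v] lets one affine substitution serve both for reversal ([u = 1], [v = -1])
    and for splitting a segment. *)
Lemma segment_integral_sub (g : C -> C) (a b : C) (u v : R) :
  Ccont_seg g a b -> 0 <= u <= 1 -> 0 <= u + v <= 1 ->
  is_RInt (V := C_R_CompleteNormedModule)
       (fun t : R => (g (segment a b t) * (b - a))%C) u (u + v)
       (segment_integral g (segment a b u) (segment a b (u + v))).
Proof.
  intros H Hu Hv.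
  assert (E : ex_RInt (V := C_R_CompleteNormedModule)
     (fun t : R => (g (segment a b t) * (b - a))%C) u (u + v)).
  { apply ex_RInt_continuous. intros t Ht.
    apply continuous_Cmult_r. apply Ccont_curve. apply H.
    revert Ht. unfold Rmin, Rmax. destruct Rle_dec; lra.
    apply segment_continuous. }
  pose proof (RInt_correct _ _ _ E) as E1.
  replace (segment_integral g (segment a b u) (segment a b (u + v))) with
    (RInt (V := C_R_CompleteNormedModule)
       (fun t : R => (g (segment a b t) * (b - a))%C) u (u + v)); [exact E1|].
  unfold segment_integral.
  assert (E2 : RInt (V := C_R_CompleteNormedModule)
       (fun t : R => (g (segment a b t) * (b - a))%C) (v * 0 + u) (v * 1 + u) =
       RInt (V := C_R_CompleteNormedModule)
       (fun t : R => (g (segment a b t) * (b - a))%C) u (u + v)) by (f_equal; ring).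
  rewrite <- E2. rewrite <- (RInt_comp_lin (V := C_R_CompleteNormedModule)).
  2:{ replace (v * 0 + u) with u by ring. replace (v * 1 + u) with (u + v) by ring. exact E. }
  apply RInt_ext. intros t _.
  replace (segment (segment a b u) (segment a b (u + v)) t) with (segment a b (v * t + u)).
  2:{ unfold segment. apply injective_projections; simpl; ring. }
  generalize (g (segment a b (v * t + u))). intros G.
  unfold scal; simpl; unfold prod_scal; simpl. unfold scal; simpl; unfold mult; simpl.
  unfold segment. apply injective_projections; simpl; ring.
Qed.

Lemma segment_0 a b : segment a b 0 = a.
Proof. unfold segment. ring. Qed.
Lemma segment_1 a b : segment a b 1 = b.
Proof. unfold segment. ring. Qed.

Lemma segment_integral_swap (g : C -> C) (a b : C) : Ccont_seg g a b -> segment_integral g b a = (- segment_integral g a b)%C.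
Proof.
  intros H. pose proof (segment_integral_sub g a b 1 (-1) H ltac:(lra) ltac:(lra)) as H1.
  replace (1 + -1) with 0 in H1 by ring. rewrite segment_0, segment_1 in H1.
  apply is_RInt_swap in H1.
  pose proof (segment_integral_is_RInt g a b H) as H2.
  apply (is_RInt_unique (V := C_R_CompleteNormedModule)) in H1. apply (is_RInt_unique (V := C_R_CompleteNormedModule)) in H2.
  rewrite H1 in H2. rewrite <- H2.
  unfold opp; simpl. unfold prod_opp, opp; simpl.
  apply injective_projections; simpl; ring.
Qed.

Lemma segment_integral_split (g : C -> C) (a b : C) (u : R) : Ccont_seg g a b -> 0 <= u <= 1 ->
  segment_integral g a b = (segment_integral g a (segment a b u) + segment_integral g (segment a b u) b)%C.
Proof.
  intros H Hu.
  pose proof (segment_integral_sub g a b 0 u H ltac:(lra) ltac:(lra)) as H1.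
  pose proof (segment_integral_sub g a b u (1 - u) H ltac:(lra) ltac:(lra)) as H2.
  replace (u + (1 - u)) with 1 in H2 by ring. rewrite Rplus_0_l in H1.
  rewrite segment_0 in H1. rewrite segment_1 in H2.
  pose proof (is_RInt_Chasles _ _ _ _ _ _ H1 H2) as H3.
  pose proof (segment_integral_is_RInt g a b H) as H4.
  apply (is_RInt_unique (V := C_R_CompleteNormedModule)) in H3. apply (is_RInt_unique (V := C_R_CompleteNormedModule)) in H4.
  rewrite <- H4, H3. reflexivity.
Qed.

(** Chain rule across two scalar fields: [G] is differentiable over the complex numbers, the curve
    only over the reals, so the increment is split by hand into the error of [G] and [l] times the
    error of [p]. *)
Lemma is_Cderive_curve (G : C -> C) (p : R -> C) (t : R) (l dp : C) :
  is_Cderive G (p t) l ->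
  is_derive (V := C_R_NormedModule) p t dp ->
  is_derive (V := C_R_NormedModule) (fun s => G (p s)) t (dp * l)%C.
Proof.
  intros HG Hp.
  assert (Hc : continuous (U := C_R_NormedModule) p t).
  { apply (ex_derive_continuous (V := C_R_NormedModule)). eexists; exact Hp. }
  assert (H0 := proj1 (is_Cderive_eps _ _ _) HG); clear HG; rename H0 into HG.
  split; [apply is_linear_scal_l|].
  intros x Hx eps.
  apply (is_filter_lim_locally_unique (K := R_AbsRing) (V := AbsRing_NormedModule R_AbsRing)) in Hx.
  change (t = x) in Hx. subst x.
  destruct Hp as [_ Hp]. specialize (Hp t (fun P HP => HP)).
  set (K := 1 + Cmod dp + Cmod l).
  assert (Kp : 0 < K) by (unfold K; pose proof (Cmod_ge_0 dp); pose proof (Cmod_ge_0 l); lra).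
  (* The total relative error is [e * (e + Cmod dp + Cmod l)]; [e <= 1] bounds the bracket by
     [K]. *)
  set (e := Rmin 1 (eps / (2 * K))).
  assert (ep : 0 < e).
  { apply Rmin_pos; [lra|]. apply Rdiv_lt_0_compat; [apply cond_pos|lra]. }
  assert (e1 : e <= 1) by apply Rmin_l.
  assert (e2 : e * (2 * K) <= eps).
  { apply Rle_trans with (eps / (2 * K) * (2 * K)).
    apply Rmult_le_compat_r; [lra|apply Rmin_r]. right; field; lra. }
  destruct (HG e ep) as [d [Hd H1]].
  specialize (Hp (mkposreal e ep)).
  rewrite continuous_curve_eps in Hc. destruct (Hc d Hd) as [d' [Hd' Hc']].
  assert (Hl : locally t (fun s => Cmod (p s - p t)%C < d)).
  { exists (mkposreal d' Hd'). intros s Hs. apply Hc'. exact Hs. }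
  generalize (filter_and _ _ Hp Hl). apply filter_imp.
  intros s [A B]. rewrite norm_C_R in A |- *. simpl in A.
  assert (S : forall (r : R) (z : C), scal (V := C_R_NormedModule) r z = (RtoC r * z)%C).
  { intros r z. unfold scal; simpl; unfold prod_scal; simpl. unfold scal; simpl; unfold mult; simpl.
    apply injective_projections; simpl; ring. }
  rewrite S in A |- *.
  change (Cmod (p s - p t - RtoC (s - t) * dp)%C <= e * Rabs (s - t)) in A.
  change (Cmod (G (p s) - G (p t) - RtoC (s - t) * (dp * l))%C <= eps * Rabs (s - t)).
  specialize (H1 _ B). rewrite Cplus_sub in H1.
  set (h := (p s - p t)%C) in *. set (r := Rabs (s - t)) in *.
  assert (rp : 0 <= r) by apply Rabs_pos.
  replace (G (p s) - G (p t) - RtoC (s - t) * (dp * l))%C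
    with ((G (p s) - G (p t) - h * l) + (h - RtoC (s - t) * dp) * l)%C by ring.
  eapply Rle_trans; [apply Cmod_triangle|]. rewrite Cmod_mult.
  assert (hb : Cmod h <= r * (e + Cmod dp)).
  { replace h with ((h - RtoC (s - t) * dp) + RtoC (s - t) * dp)%C by ring.
    eapply Rle_trans; [apply Cmod_triangle|]. rewrite Cmod_mult, Cmod_R. fold r. lra. }
  pose proof (Cmod_ge_0 dp). pose proof (Cmod_ge_0 l). pose proof (Cmod_ge_0 h).
  apply Rle_trans with (e * (r * (e + Cmod dp)) + e * r * Cmod l).
  apply Rplus_le_compat. eapply Rle_trans; [exact H1|]. apply Rmult_le_compat_l; lra.
  apply Rmult_le_compat_r; lra.
  apply Rle_trans with (r * (e * (2 * K))); [|rewrite Rmult_comm; apply Rmult_le_compat_r; lra].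
  replace (e * (r * (e + Cmod dp)) + e * r * Cmod l) with (r * (e * (e + Cmod dp + Cmod l))) by ring.
  apply Rmult_le_compat_l; [lra|]. apply Rmult_le_compat_l; [lra|]. unfold K in *. lra.
Qed.

Lemma segment_derive a b t : is_derive (V := C_R_NormedModule) (segment a b) t (b - a)%C.
Proof.
  assert (H : is_derive (V := C_R_NormedModule)
    (fun s : R => plus (a : C_R_NormedModule) (scal s ((b - a)%C : C_R_NormedModule))) t
    (plus zero (scal one ((b - a)%C : C_R_NormedModule)))).
  { apply (is_derive_plus (V := C_R_NormedModule)). apply is_derive_const.
    apply (is_derive_scal_l (V := C_R_NormedModule) (fun s => s)). apply is_derive_id. }
  rewrite plus_zero_l in H. rewrite (scal_one (V := C_R_NormedModule)) in H.
  eapply is_derive_ext; [|exact H]. intros s. unfold segment, plus, scal; simpl.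
  unfold prod_plus, prod_scal, plus, scal; simpl. unfold mult; simpl.
  apply injective_projections; simpl; ring.
Qed.

Lemma segment_integral_primitive_seg (G g : C -> C) (a b : C) : Ccont_seg g a b ->
  (forall t, 0 <= t <= 1 -> is_Cderive G (segment a b t) (g (segment a b t))) ->
  segment_integral g a b = (G b - G a)%C.
Proof.
  intros Hc HG.
  assert (H1 : forall t, Rmin 0 1 <= t <= Rmax 0 1 ->
    is_derive (V := C_R_NormedModule) (fun t => G (segment a b t)) t
      (g (segment a b t) * (b - a))%C).
  { rewrite Rmin_left, Rmax_right by lra. intros t Ht.
    rewrite Cmult_comm. apply is_Cderive_curve; [now apply HG|]. apply segment_derive. }
  assert (H2 : forall t, Rmin 0 1 <= t <= Rmax 0 1 ->
    continuous (U := C_R_NormedModule) (fun t => (g (segment a b t) * (b - a))%C) t).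
  { rewrite Rmin_left, Rmax_right by lra. intros t Ht.
    apply continuous_Cmult_r. apply Ccont_curve; [now apply Hc|]. apply segment_continuous. }
  pose proof (is_RInt_derive (V := C_R_CompleteNormedModule) _ _ 0 1 H1 H2) as H.
  cbv beta in H. rewrite segment_0, segment_1 in H.
  apply (is_RInt_unique (V := C_R_CompleteNormedModule)). exact H.
Qed.

(** * Primitives on the upper half-plane *)

Lemma segment_H a b t : upper_half a -> upper_half b -> 0 <= t <= 1 ->
  upper_half (segment a b t).
Proof.
  unfold upper_half, segment; simpl; intros Ha Hb Ht.
  replace (Im a + _) with ((1 - t) * Im a + t * Im b)
    by (unfold Im; simpl; ring).
  destruct (Req_dec t 0) as [->|]; nra.
Qed.

Lemma holomorphic_cont g a b : holomorphic_on_H g -> upper_half a -> upper_half b -> Ccont_seg g a b.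
Proof.
  intros Hg Ha Hb t Ht.
  destruct (Hg _ (segment_H a b t Ha Hb Ht)) as [l Hl].
  exact (is_Cderive_cont _ _ _ Hl).
Qed.

Definition bdry (g : C -> C) (T : C * C * C) : C :=
  let '(a, b, c) := T in (segment_integral g a b + segment_integral g b c + segment_integral g c a)%C.

Definition perimeter (T : C * C * C) : R :=
  let '(a, b, c) := T in Cmod (b - a) + Cmod (c - b) + Cmod (a - c).

(** A fixed positive height survives passage to the limit, so the point to which nested triangles
    shrink still lies in the open half-plane. *)
Definition above (mu : R) (T : C * C * C) : Prop :=
  let '(a, b, c) := T in mu <= Im a /\ mu <= Im b /\ mu <= Im c.

Definition corner (T : C * C * C) : C := fst (fst T).

Definition midpoint (a b : C) : C := segment a b (1 / 2).

Lemma Cmod_half (a b : C) : (a = RtoC (1/2) * b)%C -> Cmod a = Cmod b / 2.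
Proof. intros ->. rewrite Cmod_mult, Cmod_R, Rabs_right by lra. field. Qed.

Lemma Cmod_half_opp (a b : C) : (a = RtoC (-1/2) * b)%C -> Cmod a = Cmod b / 2.
Proof. intros ->. rewrite Cmod_mult, Cmod_R, Rabs_left by lra. field. Qed.

Ltac ceq := unfold midpoint, segment; apply injective_projections; simpl; lra.

Lemma quarter_choice (z z1 z2 z3 z4 : C) : (z = z1 + z2 + z3 + z4)%C ->
  Cmod z / 4 <= Cmod z1 \/ Cmod z / 4 <= Cmod z2 \/
  Cmod z / 4 <= Cmod z3 \/ Cmod z / 4 <= Cmod z4.
Proof.
  intros ->.
  pose proof (Cmod_triangle (z1 + z2 + z3) z4).
  pose proof (Cmod_triangle (z1 + z2) z3).
  pose proof (Cmod_triangle z1 z2).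
  destruct (Rle_dec (Cmod (z1 + z2 + z3 + z4) / 4) (Cmod z1)); auto.
  destruct (Rle_dec (Cmod (z1 + z2 + z3 + z4) / 4) (Cmod z2)); auto.
  destruct (Rle_dec (Cmod (z1 + z2 + z3 + z4) / 4) (Cmod z3)); auto.
  right; right; right. lra.
Qed.

(** The midpoints cut the triangle into four. Each midline is traversed once in either direction and
    cancels, so one of the four boundary integrals carries at least a quarter of the whole. The
    bound on the corners makes them a Cauchy sequence under iteration. *)
Lemma bisect_step (g : C -> C) (mu : R) (T : C * C * C) :
  holomorphic_on_H g -> 0 < mu -> above mu T ->
  exists T', above mu T' /\ Cmod (bdry g T) / 4 <= Cmod (bdry g T') /\
    perimeter T' = perimeter T / 2 /\ Cmod (corner T' - corner T) <= perimeter T.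
Proof.
  destruct T as [[a b] c]. intros Hg Hmu [Ha [Hb Hc]].
  set (p := midpoint a b). set (q := midpoint b c). set (r := midpoint c a).
  assert (M : forall x y, mu <= Im x -> mu <= Im y -> mu <= Im (midpoint x y)).
  { intros x y Hx Hy. unfold midpoint, segment, Im in *; simpl. lra. }
  assert (Hp : mu <= Im p) by (apply M; auto).
  assert (Hq : mu <= Im q) by (apply M; auto).
  assert (Hr : mu <= Im r) by (apply M; auto).
  assert (U : forall x, mu <= Im x -> upper_half x) by (unfold upper_half; intros; lra).
  assert (K : forall x y, mu <= Im x -> mu <= Im y -> Ccont_seg g x y)
    by (intros; apply holomorphic_cont; auto).
  assert (S : forall x y, mu <= Im x -> mu <= Im y ->
     segment_integral g x y = (segment_integral g x (midpoint x y) + segment_integral g (midpoint x y) y)%C)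
    by (intros; apply segment_integral_split; auto; lra).
  assert (E : bdry g (a, b, c) = (bdry g (a, p, r) + bdry g (p, b, q) + bdry g (r, q, c)
     + bdry g (p, q, r))%C).
  { unfold bdry. rewrite (S a b), (S b c), (S c a) by auto. fold p q r.
    rewrite (segment_integral_swap g p r), (segment_integral_swap g p q), (segment_integral_swap g q r) by auto. ring. }
  pose proof (Cmod_ge_0 (b - a)). pose proof (Cmod_ge_0 (c - b)). pose proof (Cmod_ge_0 (a - c)).
  assert (E1 : Cmod (p - a) = Cmod (b - a) / 2) by (apply Cmod_half; unfold p; ceq).
  assert (E2 : Cmod (b - p) = Cmod (b - a) / 2) by (apply Cmod_half; unfold p; ceq).
  assert (E3 : Cmod (q - b) = Cmod (c - b) / 2) by (apply Cmod_half; unfold q; ceq).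
  assert (E4 : Cmod (c - q) = Cmod (c - b) / 2) by (apply Cmod_half; unfold q; ceq).
  assert (E5 : Cmod (r - c) = Cmod (a - c) / 2) by (apply Cmod_half; unfold r; ceq).
  assert (E6 : Cmod (a - r) = Cmod (a - c) / 2) by (apply Cmod_half; unfold r; ceq).
  assert (E7 : Cmod (r - p) = Cmod (c - b) / 2) by (apply Cmod_half; unfold r, p; ceq).
  assert (E8 : Cmod (p - q) = Cmod (a - c) / 2) by (apply Cmod_half; unfold q, p; ceq).
  assert (E9 : Cmod (q - r) = Cmod (b - a) / 2) by (apply Cmod_half; unfold q, r; ceq).
  assert (E10 : Cmod (r - a) = Cmod (a - c) / 2) by (apply Cmod_half_opp; unfold r; ceq).
  assert (E11 : Cmod (p - r) = Cmod (c - b) / 2) by (apply Cmod_half_opp; unfold r, p; ceq).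
  assert (E12 : Cmod (q - p) = Cmod (a - c) / 2) by (apply Cmod_half_opp; unfold q, p; ceq).
  assert (E13 : Cmod (r - q) = Cmod (b - a) / 2) by (apply Cmod_half_opp; unfold q, r; ceq).
  destruct (quarter_choice _ _ _ _ _ E) as [H2|[H2|[H2|H2]]].
  - exists (a, p, r). repeat split; auto; unfold corner, perimeter; cbn [fst]; [lra|].
    replace (a - a)%C with (RtoC 0) by ring. rewrite Cmod_0. lra.
  - exists (p, b, q). repeat split; auto; unfold corner, perimeter; cbn [fst]; lra.
  - exists (r, q, c). repeat split; auto; unfold corner, perimeter; cbn [fst]; lra.
  - exists (p, q, r). repeat split; auto; unfold corner, perimeter; cbn [fst]; lra.
Qed.

(** The explicit rate matters: it is compared with the perimeter, which halves at the same pace. *)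
Lemma geometric_cauchy (u : nat -> R) (K : R) :
  (forall n, Rabs (u (S n) - u n) <= K / 2 ^ n) ->
  exists l, forall n, Rabs (u n - l) <= 2 * K / 2 ^ n.
Proof.
  intros H.
  assert (HK : 0 <= K).
  { specialize (H 0%nat). simpl in H. pose proof (Rabs_pos (u 1%nat - u 0%nat)). lra. }
  assert (P : forall n, 0 < 2 ^ n) by (intros; apply pow_lt; lra).
  assert (B : forall n m, Rabs (u (n + m)%nat - u n) <= 2 * K / 2 ^ n - 2 * K / 2 ^ (n + m)).
  { intros n m. induction m as [|m IH].
    - rewrite Nat.add_0_r, Rminus_diag, Rabs_R0. lra.
    - rewrite Nat.add_succ_r.
      replace (u (S (n + m)) - u n) with ((u (S (n + m)) - u (n + m)%nat) + (u (n + m)%nat - u n)) by ring.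
      eapply Rle_trans; [apply Rabs_triang|].
      specialize (H (n + m)%nat).
      assert (E : 2 * K / 2 ^ (n + m) - 2 * K / 2 ^ S (n + m) = K / 2 ^ (n + m)).
      { simpl. field. apply Rgt_not_eq, P. }
      lra. }
  assert (B' : forall n m, Rabs (u (n + m)%nat - u n) <= 2 * K / 2 ^ n).
  { intros n m. specialize (B n m).
    assert (0 <= 2 * K / 2 ^ (n + m)) by (apply Rdiv_le_0_compat; [lra|apply P]). lra. }
  assert (Cc : Cauchy_crit u).
  { intros eps He.
    assert (L : is_lim_seq (fun n => 4 * K * (/ 2) ^ n) 0).
    { replace (Finite 0) with (Rbar_mult (4 * K) 0) by (simpl; f_equal; ring).
      apply is_lim_seq_scal_l. apply is_lim_seq_geom. rewrite Rabs_right; lra. }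
    apply is_lim_seq_spec in L. destruct (L (mkposreal eps He)) as [N HN].
    exists N. intros n m Hn Hm. specialize (HN N (le_n _)). simpl in HN.
    rewrite Rminus_0_r in HN. apply Rabs_def2 in HN. rewrite pow_inv in HN.
    pose proof (B' N (n - N)%nat) as A1. pose proof (B' N (m - N)%nat) as A2.
    replace (N + (n - N))%nat with n in A1 by lia.
    replace (N + (m - N))%nat with m in A2 by lia.
    unfold Rdist. replace (u n - u m) with ((u n - u N) - (u m - u N)) by ring.
    eapply Rle_lt_trans; [apply Rabs_triang|]. rewrite Rabs_Ropp. unfold Rdiv in *. lra. }
  destruct (Rcomplete.R_complete u Cc) as [l Hl].
  exists l. intros n.
  apply is_lim_seq_Reals in Hl.
  assert (L : is_lim_seq (fun m => Rabs (u (n + m)%nat - u n)) (Rabs (l - u n))).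
  { apply (is_lim_seq_abs _ (l - u n)).
    apply (is_lim_seq_minus _ _ l (u n)); [|apply is_lim_seq_const|reflexivity].
    apply (is_lim_seq_ext (fun m => u (m + n)%nat)). intros m; f_equal; lia.
    apply -> (is_lim_seq_incr_n u n). exact Hl. }
  rewrite Rabs_minus_sym.
  apply (is_lim_seq_le _ _ (Rabs (l - u n)) (2 * K / 2 ^ n) (B' n) L (is_lim_seq_const _)).
Qed.

Lemma Cmod_le_abs (z : C) : Cmod z <= Rabs (Re z) + Rabs (Im z).
Proof.
  replace z with (RtoC (Re z) + Ci * RtoC (Im z))%C at 1.
  eapply Rle_trans; [apply Cmod_triangle|]. rewrite Cmod_mult, Cmod_Ci, !Cmod_R. lra.
  apply injective_projections; simpl; unfold Re, Im; ring.
Qed.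

Lemma Im_le_Cmod (z : C) : Rabs (Im z) <= Cmod z.
Proof. eapply Rle_trans; [|apply Rmax_Cmod]. apply Rmax_r. Qed.

Lemma segment_dist (a b z : C) t d : 0 <= t <= 1 -> Cmod (a - z) <= d -> Cmod (b - z) <= d ->
  Cmod (segment a b t - z) <= d.
Proof.
  intros Ht Ha Hb.
  replace (segment a b t - z)%C with (RtoC (1 - t) * (a - z) + RtoC t * (b - z))%C
    by (unfold segment; rewrite RtoC_minus; ring).
  eapply Rle_trans; [apply Cmod_triangle|].
  rewrite !Cmod_mult, !Cmod_R, !Rabs_right by lra. nra.
Qed.

Lemma is_Cderive_quadratic (al l z w : C) :
  is_Cderive (fun w => al * w + l * (w - z) * (w - z) / RtoC 2)%C w (al + l * (w - z))%C.
Proof.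
  apply is_Cderive_eps. intros eps He.
  assert (Hl : 0 < 1 + Cmod l) by (pose proof (Cmod_ge_0 l); lra).
  exists (eps / (1 + Cmod l)). split; [apply Rdiv_lt_0_compat; auto|].
  intros h Hh.
  assert (R2 : RtoC 2 <> 0) by (intros X; apply RtoC_inj in X; lra).
  match goal with |- Cmod ?x <= _ => assert (E : x = (l * h / RtoC 2 * h)%C) end.
  { field. }
  rewrite E.
  rewrite Cmod_mult. apply Rmult_le_compat_r; [apply Cmod_ge_0|].
  rewrite Cmod_div by exact R2. rewrite Cmod_R, Rabs_right by lra. rewrite Cmod_mult.
  apply (Rmult_lt_compat_r _ _ _ Hl) in Hh.
  unfold Rdiv in Hh. rewrite Rmult_assoc, Rinv_l in Hh by lra.
  pose proof (Cmod_ge_0 h). pose proof (Cmod_ge_0 l). nra.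
Qed.

Lemma holomorphic_minus_affine g (al l z : C) :
  holomorphic_on_H g -> holomorphic_on_H (fun w => g w + (- al - l * (w - z)))%C.
Proof.
  intros Hg w Hw. destruct (Hg w Hw) as [m Hm].
  exists (m - l)%C. apply is_Cderive_eps. intros eps He.
  destruct (proj1 (is_Cderive_eps _ _ _) Hm eps He) as [d [Hd H]].
  exists d; split; auto. intros h Hh. specialize (H h Hh).
  replace (g (w + h) + (- al - l * (w + h - z)) - (g w + (- al - l * (w - z))) - h * (m - l))%C
   with (g (w + h) - g w - h * m)%C by ring. exact H.
Qed.

Lemma holomorphic_affine (al l z : C) : holomorphic_on_H (fun w => al + l * (w - z))%C.
Proof.
  intros w _. exists l. apply is_Cderive_eps. intros eps He. exists 1. split; [lra|].
  intros h _. replace (al + l * (w + h - z) - (al + l * (w - z)) - h * l)%C with (RtoC 0) by ring.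
  rewrite Cmod_0. apply Rmult_le_pos; [lra|apply Cmod_ge_0].
Qed.

(** The affine part has a quadratic primitive, so it contributes a difference of endpoint values,
    which cancels around a triangle. With slope 0 the same identity subtracts a constant. *)
Lemma segment_integral_minus_affine g (al l z a b : C) : holomorphic_on_H g -> upper_half a -> upper_half b ->
  segment_integral g a b = (segment_integral (fun w => g w + (- al - l * (w - z)))%C a b +
    ((al * b + l * (b - z) * (b - z) / RtoC 2) - (al * a + l * (a - z) * (a - z) / RtoC 2)))%C.
Proof.
  intros Hg Ha Hb.
  pose proof (segment_integral_primitive_seg (fun w => al * w + l * (w - z) * (w - z) / RtoC 2)%C
    (fun w => al + l * (w - z))%C a b (holomorphic_cont _ _ _ (holomorphic_affine al l z) Ha Hb)
    (fun t _ => is_Cderive_quadratic al l z _)) as E.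
  rewrite <- E. rewrite <- segment_integral_plus.
  - unfold segment_integral. apply (RInt_ext (V := C_R_CompleteNormedModule)). intros t _.
    match goal with |- ?x = ?y => change (x = y :> C) end. ring.
  - apply holomorphic_cont; auto. apply holomorphic_minus_affine; auto.
  - apply holomorphic_cont; auto. apply holomorphic_affine.
Qed.

(** Once the affine part is removed, the integrand is at most [eps] times the distance to [z], and
    every point of the boundary is within [Cmod (corner T - z) + perimeter T] of [z]. *)
Lemma goursat_local g z l eps : holomorphic_on_H g -> upper_half z -> is_Cderive g z l -> 0 < eps ->
  exists delta, 0 < delta /\ forall T mu, 0 < mu -> above mu T ->
    Cmod (corner T - z) + perimeter T < delta ->
    Cmod (bdry g T) <= eps * (Cmod (corner T - z) + perimeter T) * perimeter T.
Proof.
  intros Hg Hz Hl He.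
  destruct (proj1 (is_Cderive_eps _ _ _) Hl eps He) as [d [Hd H]].
  exists d. split; auto. intros [[a b] c] mu Hmu [Ha [Hb Hc]]. unfold corner, perimeter. cbn [fst].
  set (D := Cmod (a - z) + (Cmod (b - a) + Cmod (c - b) + Cmod (a - c))). intros HD.
  assert (U : forall x, mu <= Im x -> upper_half x) by (unfold upper_half; intros; lra).
  pose proof (Cmod_ge_0 (b - a)). pose proof (Cmod_ge_0 (c - b)). pose proof (Cmod_ge_0 (a - c)).
  assert (da : Cmod (a - z) <= D) by (unfold D; lra).
  assert (db : Cmod (b - z) <= D).
  { replace (b - z)%C with ((a - z) + (b - a))%C by ring.
    eapply Rle_trans; [apply Cmod_triangle|]. unfold D; lra. }
  assert (dc : Cmod (c - z) <= D).
  { replace (c - z)%C with ((b - z) + (c - b))%C by ring.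
    replace (b - z)%C with ((a - z) + (b - a))%C by ring.
    eapply Rle_trans; [apply Cmod_triangle|].
    eapply Rle_trans; [apply Rplus_le_compat_r, Cmod_triangle|]. unfold D; lra. }
  set (g' := fun w => (g w + (- g z - l * (w - z)))%C).
  assert (B : forall x y, mu <= Im x -> mu <= Im y -> Cmod (x - z) <= D -> Cmod (y - z) <= D ->
    Cmod (segment_integral g' x y) <= eps * D * Cmod (y - x)).
  { intros x y Hx Hy dx dy. apply segment_integral_bound.
    - apply holomorphic_cont; auto. apply holomorphic_minus_affine; auto.
    - intros t Ht. set (w := segment x y t).
      assert (dw : Cmod (w - z) <= D) by (apply segment_dist; auto).
      specialize (H (w - z)%C ltac:(lra)). rewrite Cplus_sub in H.
      unfold g'. replace (g w + (- g z - l * (w - z)))%C with (g w - g z - (w - z) * l)%C by ring.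
      eapply Rle_trans; [exact H|]. apply Rmult_le_compat_l; lra. }
  unfold bdry.
  rewrite (segment_integral_minus_affine g (g z) l z a b), (segment_integral_minus_affine g (g z) l z b c),
    (segment_integral_minus_affine g (g z) l z c a) by auto.
  fold g'.
  match goal with |- Cmod ?x <= _ => replace x with (segment_integral g' a b + segment_integral g' b c + segment_integral g' c a)%C by ring end.
  eapply Rle_trans; [apply Cmod_triangle|].
  eapply Rle_trans; [apply Rplus_le_compat_r, Cmod_triangle|].
  pose proof (B a b Ha Hb da db). pose proof (B b c Hb Hc db dc). pose proof (B c a Hc Ha dc da).
  lra.
Qed.

Theorem goursat g a b c : holomorphic_on_H g -> upper_half a -> upper_half b -> upper_half c ->
  (segment_integral g a b + segment_integral g b c + segment_integral g c a = 0)%C.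
Proof.
  intros Hg Ha Hb Hc.
  set (mu := Rmin (Im a) (Rmin (Im b) (Im c))).
  assert (Hmu : 0 < mu) by (repeat apply Rmin_pos; assumption).
  assert (H0 : above mu (a, b, c)).
  { unfold above, mu. repeat split.
    apply Rmin_l. eapply Rle_trans; [apply Rmin_r|apply Rmin_l].
    eapply Rle_trans; [apply Rmin_r|apply Rmin_r]. }
  set (P := perimeter (a, b, c)).
  (* Choice of one of the four subtriangles; its specification holds as long as the triangle stays
     above height [mu]. *)
  set (nxt := fun (T : C * C * C) => epsilon (inhabits T) (fun T' =>
    above mu T' /\ Cmod (bdry g T) / 4 <= Cmod (bdry g T') /\
    perimeter T' = perimeter T / 2 /\ Cmod (corner T' - corner T) <= perimeter T)).
  set (Ts := fun n => Nat.iter n nxt (a, b, c)).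
  assert (Ab : forall n, above mu (Ts n)).
  { induction n as [|n IH]; [exact H0|].
    exact (proj1 (epsilon_spec (inhabits (Ts n)) _ (bisect_step g mu _ Hg Hmu IH))). }
  assert (St : forall n, Cmod (bdry g (Ts n)) / 4 <= Cmod (bdry g (Ts (S n))) /\
    perimeter (Ts (S n)) = perimeter (Ts n) / 2 /\
    Cmod (corner (Ts (S n)) - corner (Ts n)) <= perimeter (Ts n)).
  { intros n. exact (proj2 (epsilon_spec (inhabits (Ts n)) _ (bisect_step g mu _ Hg Hmu (Ab n)))). }
  assert (T0 : Ts 0%nat = (a, b, c)) by reflexivity.
  clearbody Ts. clear nxt.
  assert (P2 : forall n, 0 < 2 ^ n) by (intros; apply pow_lt; lra).
  assert (Pn : forall n, perimeter (Ts n) = P / 2 ^ n).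
  { induction n as [|n IH]. rewrite T0. unfold P; simpl; field.
    rewrite (proj1 (proj2 (St n))), IH. simpl. field. apply Rgt_not_eq, P2. }
  assert (Bn : forall n, Cmod (bdry g (a, b, c)) <= Cmod (bdry g (Ts n)) * (2 ^ n * 2 ^ n)).
  { induction n as [|n IH]. rewrite T0; simpl; lra.
    eapply Rle_trans; [exact IH|]. pose proof (proj1 (St n)) as A. simpl.
    pose proof (P2 n). assert (0 < 2 ^ n * 2 ^ n) by nra.
    apply Rle_trans with (4 * Cmod (bdry g (Ts (S n))) * (2 ^ n * 2 ^ n)); [|lra].
    apply Rmult_le_compat_r; lra. }
  destruct (geometric_cauchy (fun n => Re (corner (Ts n))) P) as [x Hx].
  { intros n. rewrite <- Pn. eapply Rle_trans; [|apply (proj2 (proj2 (St n)))].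
    eapply Rle_trans; [|apply re_le_Cmod]. right. f_equal. }
  destruct (geometric_cauchy (fun n => Im (corner (Ts n))) P) as [y Hy].
  { intros n. rewrite <- Pn. eapply Rle_trans; [|apply (proj2 (proj2 (St n)))].
    eapply Rle_trans; [|apply Im_le_Cmod]. right. f_equal. }
  set (z := (x, y) : C).
  assert (Hz : forall n, Cmod (corner (Ts n) - z) <= 4 * P / 2 ^ n).
  { intros n. eapply Rle_trans; [apply Cmod_le_abs|].
    specialize (Hx n). specialize (Hy n).
    change (Rabs (Re (corner (Ts n)) - x) + Rabs (Im (corner (Ts n)) - y) <= 4 * P / 2 ^ n).
    unfold Rdiv in *. lra. }
  assert (HP : 0 <= P).
  { unfold P, perimeter. pose proof (Cmod_ge_0 (b - a)). pose proof (Cmod_ge_0 (c - b)).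
    pose proof (Cmod_ge_0 (a - c)). lra. }
  assert (L : forall e, 0 < e -> exists n, P / 2 ^ n < e).
  { intros e He.
    assert (L : is_lim_seq (fun n => P * (/ 2) ^ n) 0).
    { replace (Finite 0) with (Rbar_mult P 0) by (simpl; f_equal; ring).
      apply is_lim_seq_scal_l. apply is_lim_seq_geom. rewrite Rabs_right; lra. }
    apply is_lim_seq_spec in L. destruct (L (mkposreal e He)) as [N HN].
    exists N. specialize (HN N (le_n _)). simpl in HN.
    rewrite Rminus_0_r in HN. apply Rabs_def2 in HN. rewrite pow_inv in HN. apply HN. }
  (* The corners keep height at least [mu] and come within [mu / 2] of the limit. *)
  assert (Uz : upper_half z).
  { apply Rnot_le_lt. intros Ny. change (y <= 0) in Ny.
    destruct (L (mu / 4) ltac:(lra)) as [n Hn]. specialize (Hy n).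
    assert (mu <= Im (corner (Ts n))).
    { specialize (Ab n). destruct (Ts n) as [[a' b'] c']. apply Ab. }
    apply Rabs_le_between in Hy. unfold Rdiv in *. lra. }
  destruct (Hg z Uz) as [l Hl].
  assert (Z : Cmod (bdry g (a, b, c)) <= 0).
  { apply Rle_plus_epsilon. intros eps He.
    (* With [r = P / 2 ^ n], the corner is within [4 * r] of [z] and the perimeter is [r]; the
       factor 4^n lost by bisection turns the bound [5 * r * r] into [5 * P * P]. Using [P + 1]
       avoids dividing by zero for a degenerate triangle. *)
    set (e := eps / (5 * (P + 1) * (P + 1))).
    assert (Q : 0 < 5 * (P + 1) * (P + 1)) by nra.
    assert (ep : 0 < e) by (apply Rdiv_lt_0_compat; auto).
    destruct (goursat_local g z l e Hg Uz Hl ep) as [d [Hd H]].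
    destruct (L (d / 5) ltac:(lra)) as [n Hn].
    specialize (Hz n).
    specialize (H (Ts n) mu Hmu (Ab n)). rewrite Pn in H.
    set (r := P / 2 ^ n) in *.
    replace (4 * P / 2 ^ n) with (4 * r) in Hz by (unfold r; field; apply Rgt_not_eq, P2).
    specialize (H ltac:(lra)).
    assert (hr : 0 <= r) by (apply Rdiv_le_0_compat; auto).
    eapply Rle_trans; [apply (Bn n)|].
    apply Rle_trans with (e * (5 * r) * r * (2 ^ n * 2 ^ n)).
    { apply Rmult_le_compat_r. pose proof (P2 n); nra.
      eapply Rle_trans; [exact H|]. apply Rmult_le_compat_r; [exact hr|].
      apply Rmult_le_compat_l; lra. }
    replace (e * (5 * r) * r * (2 ^ n * 2 ^ n)) with (e * (5 * P * P))
      by (unfold r; field; apply Rgt_not_eq, P2).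
    rewrite Rplus_0_l. apply Rle_trans with (e * (5 * (P + 1) * (P + 1))).
    apply Rmult_le_compat_l; nra. unfold e. right. field. lra. }
  apply Cmod_eq_0. apply Rle_antisym; [exact Z|apply Cmod_ge_0].
Qed.

Lemma segment_integral_add g a b c : holomorphic_on_H g -> upper_half a -> upper_half b -> upper_half c ->
  segment_integral g a c = (segment_integral g a b + segment_integral g b c)%C.
Proof.
  intros Hg Ha Hb Hc. pose proof (goursat g a b c Hg Ha Hb Hc) as H.
  rewrite (segment_integral_swap g a c) in H by (apply holomorphic_cont; auto).
  replace (segment_integral g a c) with (segment_integral g a c + 0)%C by ring. rewrite <- H. ring.
Qed.

(** The half-plane is convex, so integrating along segments from a fixed point works; Goursat for
    the triangle [Ci], [z], [z + h] reduces the increment to one short segment. *)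
Theorem holomorphic_primitive g : holomorphic_on_H g ->
  exists G, forall z, upper_half z -> is_Cderive G z (g z).
Proof.
  intros Hg. exists (segment_integral g Ci). intros z Hz.
  assert (Hi : upper_half Ci) by (unfold upper_half; simpl; lra).
  apply is_Cderive_eps. intros eps He.
  destruct (Hg z Hz) as [l Hl].
  destruct (is_Cderive_cont _ _ _ Hl eps He) as [d [Hd H]].
  exists (Rmin d (Im z)). split; [apply Rmin_pos; auto|].
  intros h Hh.
  assert (h1 := Rlt_le_trans _ _ _ Hh (Rmin_l _ _)).
  assert (h2 := Rlt_le_trans _ _ _ Hh (Rmin_r _ _)).
  assert (Hzh : upper_half (z + h)%C).
  { unfold upper_half. rewrite im_plus. pose proof (Im_le_Cmod h) as A.
    apply Rabs_le_between in A. lra. }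
  rewrite (segment_integral_add g Ci z (z + h)) by auto.
  (* Slope 0 removes just the constant [g z]; what remains is small by continuity of [g]. *)
  rewrite (segment_integral_minus_affine g (g z) 0 z z (z + h)) by auto.
  match goal with |- Cmod ?x <= _ => assert (E : x =
    segment_integral (fun w => g w + (- g z - 0 * (w - z)))%C z (z + h)) end.
  { field. }
  rewrite E.
  replace (eps * Cmod h) with (eps * Cmod (z + h - z)) by (do 2 f_equal; ring).
  apply segment_integral_bound. apply holomorphic_cont; auto. apply holomorphic_minus_affine; auto.
  intros t Ht.
  replace (g (segment z (z + h) t) + (- g z - 0 * (segment z (z + h) t - z)))%C
    with (g (z + RtoC t * h) - g z)%C.
  2:{ unfold segment. replace (z + h - z)%C with h by ring. ring. }
  left. apply H. rewrite Cmod_mult, Cmod_R, Rabs_right by lra.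
  pose proof (Cmod_ge_0 h). nra.
Qed.

Lemma segment_integral_primitive G g a b : holomorphic_on_H g -> (forall z, upper_half z -> is_Cderive G z (g z)) ->
  upper_half a -> upper_half b -> segment_integral g a b = (G b - G a)%C.
Proof.
  intros Hg HG Ha Hb. apply segment_integral_primitive_seg. apply holomorphic_cont; auto.
  intros t Ht. apply HG. apply segment_H; auto.
Qed.

(** * Words in T and V *)

(** The product and chain rules are applied over [AbsRing_NormedModule C_AbsRing]; the derivative
    condition is the same there. *)
Lemma is_Cderive_ring (f : C -> C) z l :
  is_Cderive f z l <->
  is_derive (K := C_AbsRing) (V := AbsRing_NormedModule C_AbsRing) f z l.
Proof.
  split; intros [_ H]; (split; [apply is_linear_scal_l|exact H]).
Qed.

Lemma is_Cderive_mult (f g : C -> C) z df dg : is_Cderive f z df -> is_Cderive g z dg ->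
  is_Cderive (fun w => f w * g w)%C z (df * g z + f z * dg)%C.
Proof.
  rewrite !is_Cderive_ring. intros Hf Hg.
  exact (is_derive_mult (K := C_AbsRing) f g z df dg Hf Hg Cmult_comm).
Qed.

Lemma is_Cderive_comp (f g : C -> C) z df dg : is_Cderive f (g z) df -> is_Cderive g z dg ->
  is_Cderive (fun w => f (g w)) z (dg * df)%C.
Proof.
  rewrite (is_Cderive_ring g). intros Hf Hg.
  exact (is_derive_comp (K := C_AbsRing) (V := C_NormedModule) f g z df dg Hf Hg).
Qed.

Lemma is_Cderive_minus (f g : C -> C) z df dg : is_Cderive f z df -> is_Cderive g z dg ->
  is_Cderive (fun w => f w - g w)%C z (df - dg)%C.
Proof.
  intros Hf Hg. exact (is_derive_minus (K := C_AbsRing) (V := C_NormedModule) f g z df dg Hf Hg).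
Qed.

Lemma upper_half_neq (z : C) (a b : R) : upper_half z -> (a <> 0 \/ b <> 0) ->
  (RtoC a * z + RtoC b)%C <> 0.
Proof.
  unfold upper_half. destruct z as [u v]. simpl. intros Hv Hab E.
  injection E as E1 E2. assert (a = 0) by nra. subst a. lra.
Qed.

Lemma upper_half_neq1 (z : C) (b : R) : upper_half z -> (z + RtoC b)%C <> 0.
Proof.
  intros Hz. replace z with (RtoC 1 * z)%C by ring. apply upper_half_neq; auto.
Qed.

Lemma is_Cderive_inv_shift (a : R) (z : C) : upper_half z ->
  is_Cderive (fun w => / (w + RtoC a))%C z (- / ((z + RtoC a) * (z + RtoC a)))%C.
Proof.
  intros Hz. apply is_Cderive_eps. intros eps He.
  set (m := Im z). assert (Hm : 0 < m) by exact Hz.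
  assert (M3 : 0 < eps * (m * m * m)) by (repeat apply Rmult_lt_0_compat; auto).
  (* Keeping [h] below [m / 2] leaves [z + h] at height at least [m / 2], so the denominator of the
     error has modulus at least [m * m * (m / 2)]. *)
  exists (Rmin (m / 2) (eps * (m * m * m) / 2)).
  split; [apply Rmin_pos; lra|].
  intros h Hh.
  assert (h1 := Rlt_le_trans _ _ _ Hh (Rmin_l _ _)).
  assert (h2 := Rlt_le_trans _ _ _ Hh (Rmin_r _ _)).
  assert (Ih : Rabs (Im h) < m / 2) by (eapply Rle_lt_trans; [apply Im_le_Cmod|lra]).
  apply Rabs_def2 in Ih.
  assert (Hzh : upper_half (z + h)%C) by (unfold upper_half; rewrite im_plus; fold m; lra).
  assert (N1 := upper_half_neq1 z a Hz). assert (N2 := upper_half_neq1 _ a Hzh).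
  assert (E : (/ (z + h + a) - / (z + a) - h * - / ((z + a) * (z + a)))%C =
    (h * (h / ((z + a) * (z + a) * (z + h + a))))%C) by (field; auto).
  rewrite E, Cmod_mult, Rmult_comm. apply Rmult_le_compat_r; [apply Cmod_ge_0|].
  assert (N3 : ((z + a) * (z + a) * (z + h + a))%C <> 0).
  { intros X. apply Cmod_gt_0 in N1. apply Cmod_gt_0 in N2.
    apply (f_equal Cmod) in X. rewrite !Cmod_mult, Cmod_0 in X.
    pose proof (Rmult_lt_0_compat _ _ (Rmult_lt_0_compat _ _ N1 N1) N2). lra. }
  rewrite Cmod_div by exact N3. rewrite !Cmod_mult.
  assert (B1 : m <= Cmod (z + a)).
  { eapply Rle_trans; [|apply Im_le_Cmod]. rewrite im_plus, im_RtoC, Rplus_0_r.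
    apply Rle_abs. }
  assert (B2 : m / 2 <= Cmod (z + h + a)).
  { eapply Rle_trans; [|apply Im_le_Cmod]. rewrite !im_plus, im_RtoC, Rplus_0_r.
    eapply Rle_trans; [|apply Rle_abs]. fold m. lra. }
  set (p := Cmod (z + a)) in *. set (q := Cmod (z + h + a)) in *.
  assert (B3 : m * m * (m / 2) <= p * p * q).
  { apply Rmult_le_compat; [nra|lra|apply Rmult_le_compat; lra|lra]. }
  assert (0 < m * m * (m / 2)) by (repeat apply Rmult_lt_0_compat; lra).
  apply Rle_div_l; [lra|].
  apply Rle_trans with (eps * (m * m * (m / 2))); [lra|].
  apply Rmult_le_compat_l; lra.
Qed.

Definition lmat (b : bool) : mat2 := if b then mat_T else mat_V.
Definition word_mat (L : list bool) : mat2 := fold_right mat_mul mat_id (map lmat L).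
Definition act (b : bool) (x : R) : R := if b then x + 1 else x / (x + 1).
Definition acts (L : list bool) (x : R) : R := fold_right act x L.
Definition cact (b : bool) (z : C) : C := if b then (z + 1)%C else (z / (z + 1))%C.
Definition cacts (L : list bool) (z : C) : C := fold_right cact z L.

Lemma act_pos b x : 0 < x -> 0 < act b x.
Proof. destruct b; simpl; intros; [lra|]. apply Rdiv_lt_0_compat; lra. Qed.

Lemma acts_pos L x : 0 < x -> 0 < acts L x.
Proof. intros Hx. induction L; simpl; auto. now apply act_pos. Qed.

Lemma upper_half_one_plus z : upper_half z -> (z + 1)%C <> 0.
Proof. apply upper_half_neq1. Qed.

Lemma cact_H b z : upper_half z -> upper_half (cact b z).
Proof.
  intros Hz. destruct b; simpl.
  - unfold upper_half in *. rewrite im_plus, im_RtoC. lra.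
  - destruct z as [u v]. unfold upper_half in *. simpl in *.
    assert (P : 0 < (u + 1) * (u + 1) + v * v).
    { pose proof (Rle_0_sqr (u + 1)) as A. unfold Rsqr in A.
      pose proof (Rmult_lt_0_compat _ _ Hz Hz). lra. }
    match goal with |- 0 < ?x => replace x with (v / ((u + 1) * (u + 1) + v * v)) end.
    + apply Rdiv_lt_0_compat; lra.
    + field. lra.
Qed.

Lemma cacts_H L z : upper_half z -> upper_half (cacts L z).
Proof. intros Hz. induction L; simpl; auto. now apply cact_H. Qed.

Lemma mat_det_mul A B : mat_det (mat_mul A B) = (mat_det A * mat_det B)%Z.
Proof. destruct A as [a b c d], B as [p q r s]. unfold mat_det, mat_mul. cbn [m11 m12 m21 m22]. ring. Qed.

Lemma mat_det_lmat b : mat_det (lmat b) = 1%Z.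
Proof. destruct b; reflexivity. Qed.

Lemma word_mat_det L : mat_det (word_mat L) = 1%Z.
Proof.
  induction L as [|b L IH]; [reflexivity|].
  change (word_mat (b :: L)) with (mat_mul (lmat b) (word_mat L)).
  now rewrite mat_det_mul, mat_det_lmat, IH.
Qed.

Lemma lmat_mul b p q r s : mat_mul (lmat b) (Mat p q r s) =
  if b then Mat (p + r) (q + s) r s else Mat p q (p + r) (q + s).
Proof. destruct b; unfold mat_mul, lmat; cbn [mat_T mat_V m11 m12 m21 m22]; f_equal; ring. Qed.

Lemma mat_denominator A z : mat_det A = 1%Z -> upper_half z ->
  (ZtoC (m21 A) * z + ZtoC (m22 A))%C <> 0.
Proof.
  intros HA Hz. apply upper_half_neq; auto.
  destruct (Z.eq_dec (m21 A) 0) as [E|E]; [right|left]; apply not_0_IZR; auto.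
  unfold mat_det in HA. nia.
Qed.

Lemma moebC_lmat_mul b A z : mat_det A = 1%Z -> upper_half z ->
  moebC (mat_mul (lmat b) A) z = cact b (moebC A z).
Proof.
  intros HA Hz. pose proof (mat_denominator A z HA Hz) as N1.
  assert (HB : mat_det (mat_mul (lmat b) A) = 1%Z)
    by now rewrite mat_det_mul, mat_det_lmat, HA.
  pose proof (mat_denominator _ z HB Hz) as N2.
  destruct A as [p q r s]. rewrite lmat_mul in *. unfold moebC, ZtoC, cact in *.
  destruct b; cbn [m11 m12 m21 m22] in *; rewrite ?plus_IZR, ?RtoC_plus in *.
  - field; auto.
  - field. repeat split; auto. intros X. apply N2. rewrite <- X. ring.
Qed.

Lemma moebC_word L z : upper_half z -> moebC (word_mat L) z = cacts L z.
Proof.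
  intros Hz. induction L as [|b L IH].
  - unfold moebC, word_mat; simpl. unfold ZtoC. field.
  - change (word_mat (b :: L)) with (mat_mul (lmat b) (word_mat L)).
    rewrite moebC_lmat_mul; auto using word_mat_det. simpl. now rewrite IH.
Qed.

Definition SL2Z_letters (f : C -> C) : Prop :=
  forall b z, upper_half z -> f (cact b z) = f z.

Lemma SL2Z_invariant_letters f : SL2Z_invariant f -> SL2Z_letters f.
Proof.
  intros H b z Hz. rewrite <- (H (word_mat [b]) z); auto using word_mat_det.
  now rewrite moebC_word.
Qed.

(* For a hyperbolic matrix with repelling fixed point [-y] and attracting fixed
   point [x] this is the kernel [sqrt D / Q(tau,1)]. *)
Definition omega (y x : R) (z : C) : C := (/ (z + RtoC y) - / (z + RtoC (- x)))%C.

Definition primitive_of (f : C -> C) (y x : R) (G : C -> C) : Prop :=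
  forall z, upper_half z -> is_Cderive G z (f z * omega y x z)%C.

Definition dcact (b : bool) (z : C) : C := if b then RtoC 1 else (/ ((z + 1) * (z + 1)))%C.

Lemma cact_derive b z : upper_half z ->
  is_Cderive (cact b) z (dcact b z).
Proof.
  intros Hz. destruct b.
  - apply is_Cderive_eps. intros eps He. exists 1; split; [lra|]. intros h _.
    unfold cact, dcact. replace (z + h + 1 - (z + 1) - h * 1)%C with (RtoC 0) by ring.
    rewrite Cmod_0. apply Rmult_le_pos; [lra|apply Cmod_ge_0].
  - pose proof (is_Cderive_inv_shift 1 z Hz) as H.
    apply is_Cderive_eps. intros eps He.
    destruct (proj1 (is_Cderive_eps _ _ _) H eps He) as [d [Hd H1]].
    exists (Rmin d (Im z)). split; [apply Rmin_pos; auto|]. intros h Hh.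
    specialize (H1 h (Rlt_le_trans _ _ _ Hh (Rmin_l _ _))).
    assert (h2 := Rlt_le_trans _ _ _ Hh (Rmin_r _ _)).
    assert (Hzh : upper_half (z + h)%C).
    { unfold upper_half. rewrite im_plus. pose proof (Im_le_Cmod h) as A.
      apply Rabs_le_between in A. lra. }
    assert (N1 := upper_half_one_plus z Hz). assert (N2 := upper_half_one_plus _ Hzh).
    eapply Rle_trans; [|exact H1]. rewrite <- (Cmod_opp (/ _ - _ - _)). right. f_equal.
    unfold cact, dcact. field. auto.
Qed.

(** The differential has poles at [- y] and at the attracting point. Pull-back by a letter applies
    the inverse letter to both: the second becomes [x], while [- y] becomes [- act b y]. Hence the
    two orbits run in opposite directions along the word, which is why reversed words appear. *)
Lemma omega_cact b y x z : 0 < y -> 0 < x -> upper_half z ->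
  (dcact b z * omega y (act b x) (cact b z) =
   omega (act b y) x z)%C.
Proof.
  intros Hy Hx Hz. unfold omega.
  assert (N1 := upper_half_one_plus z Hz).
  destruct b; unfold act, cact, dcact.
  - rewrite RtoC_plus, !RtoC_opp, RtoC_plus.
    assert (N2 := upper_half_neq1 z (- x) Hz). rewrite RtoC_opp in N2.
    assert (N3 := upper_half_neq1 z (y + 1) Hz). rewrite RtoC_plus in N3.
    field. repeat split; auto.
    all: try (intros X; apply N2; rewrite <- X; ring).
    all: try (intros X; apply N3; rewrite <- X; ring).
  - rewrite !RtoC_opp, !RtoC_div, !RtoC_plus by lra.
    assert (N2 := upper_half_neq1 z (- x) Hz). rewrite RtoC_opp in N2.
    assert (Hy1 : y + 1 <> 0) by lra.
    assert (N3 := upper_half_neq z (y + 1) y Hz (or_introl Hy1)).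
    rewrite RtoC_plus in N3.
    assert (N4 : (RtoC y + 1)%C <> 0) by (rewrite <- RtoC_plus; intros X; apply RtoC_inj in X; lra).
    assert (N5 : (RtoC x + 1)%C <> 0) by (rewrite <- RtoC_plus; intros X; apply RtoC_inj in X; lra).
    field. repeat split; auto.
    all: try (intros X; apply N2; rewrite <- X; ring).
    all: try (intros X; apply N3; rewrite <- X; ring).
Qed.

Lemma primitive_of_act f b y x G : SL2Z_letters f -> 0 < y -> 0 < x ->
  primitive_of f y (act b x) G -> primitive_of f (act b y) x (fun z => G (cact b z)).
Proof.
  intros Hf Hy Hx HG z Hz.
  rewrite <- (omega_cact b y x z Hy Hx Hz), <- (Hf b z Hz).
  match goal with |- is_derive _ _ ?l => replace l with
   (dcact b z * (f (cact b z) * omega y (act b x) (cact b z)))%C by ring end.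
  apply is_Cderive_comp; [apply HG; now apply cact_H|now apply cact_derive].
Qed.

Lemma primitive_of_acts f L y x G : SL2Z_letters f -> 0 < y -> 0 < x ->
  primitive_of f y (acts L x) G ->
  primitive_of f (acts (rev L) y) x (fun z => G (cacts L z)).
Proof.
  intros Hf. revert y G. induction L as [|b L IH]; intros y G Hy Hx HG; [exact HG|].
  simpl in *. unfold acts at 1. rewrite fold_right_app. simpl.
  apply (IH (act b y) (fun z => G (cact b z))); auto using act_pos.
  apply primitive_of_act; auto using acts_pos.
Qed.

(** * Reduction to an arc of the unit circle *)

Definition ker (c x : R) : R := x / (x ^ 2 + 1 - 2 * c * x).
Definition Phi (f : C -> C) (t : R) : R := Re (f (cos t, sin t)) * sin t.

Lemma holomorphic_omega y x : holomorphic_on_H (omega y x).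
Proof.
  intros z Hz. eexists. unfold omega.
  apply is_Cderive_minus; apply is_Cderive_inv_shift; exact Hz.
Qed.

Lemma holomorphic_mult f g : holomorphic_on_H f -> holomorphic_on_H g -> holomorphic_on_H (fun z => f z * g z)%C.
Proof.
  intros Hf Hg z Hz. destruct (Hf z Hz) as [a Ha]. destruct (Hg z Hz) as [b Hb].
  eexists. apply is_Cderive_mult; eassumption.
Qed.

Lemma primitive_exists f y x : holomorphic_on_H f -> exists G, primitive_of f y x G.
Proof.
  intros Hf. exact (holomorphic_primitive _ (holomorphic_mult _ _ Hf (holomorphic_omega y x))).
Qed.

Definition circle (t : R) : C := (cos t, sin t).

Lemma circle_derive t : is_derive (V := C_R_NormedModule) circle t (Ci * circle t)%C.
Proof.
  assert (H : is_derive (V := C_R_NormedModule)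
    (fun s : R => plus (scal (cos s) (RtoC 1 : C_R_NormedModule))
        (scal (sin s) (Ci : C_R_NormedModule))) t
    (plus (scal (- sin t) (RtoC 1 : C_R_NormedModule))
        (scal (cos t) (Ci : C_R_NormedModule)))).
  { apply (is_derive_plus (V := C_R_NormedModule));
      apply (is_derive_scal_l (V := C_R_NormedModule)).
    apply is_derive_cos. apply is_derive_sin. }
  replace (Ci * circle t)%C with (plus (scal (- sin t) (RtoC 1 : C_R_NormedModule))
        (scal (cos t) (Ci : C_R_NormedModule))).
  - eapply is_derive_ext; [|exact H]. intros s. unfold circle, plus, scal; simpl.
    unfold prod_plus, prod_scal, plus, scal; simpl. unfold mult; simpl.
    apply injective_projections; simpl; ring.
  - unfold circle, plus, scal; simpl.
    unfold prod_plus, prod_scal, plus, scal; simpl. unfold mult; simpl.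
    apply injective_projections; simpl; ring.
Qed.

Lemma circle_H t : PI / 3 <= t <= 2 * PI / 3 -> upper_half (circle t).
Proof. intros Ht. apply sin_gt_0; pose proof PI_RGT_0; lra. Qed.

Lemma holomorphic_rotate : holomorphic_on_H (fun z => Ci * z)%C.
Proof.
  intros z _. exists Ci. apply is_Cderive_eps. intros eps He. exists 1. split; [lra|].
  intros h _. replace (Ci * (z + h) - Ci * z - h * Ci)%C with (RtoC 0) by ring.
  rewrite Cmod_0. apply Rmult_le_pos; [lra|apply Cmod_ge_0].
Qed.

Lemma arc_bounds : PI / 3 <= 2 * PI / 3.
Proof. pose proof PI_RGT_0; lra. Qed.

Definition real_nonneg_on_arc (f : C -> C) : Prop :=
  forall t : R, PI / 3 <= t <= 2 * PI / 3 ->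
       Im (f (cos t, sin t)) = 0 /\ 0 <= Re (f (cos t, sin t)).

Lemma ker_denominator c x : Rabs c < 1 -> 0 < x ^ 2 + 1 - 2 * c * x.
Proof.
  intros Hc. apply Rabs_def2 in Hc.
  assert (0 < (1 - c) * (1 + c)) by (apply Rmult_lt_0_compat; lra).
  pose proof (pow2_ge_0 (x - c)). lra.
Qed.

Lemma Rabs_cos_lt t : 0 < sin t -> Rabs (cos t) < 1.
Proof.
  intros Hs. pose proof (sin2_cos2 t) as S. unfold Rsqr in S.
  assert (0 < sin t * sin t) by (apply Rmult_lt_0_compat; auto).
  apply Rabs_def1; nra.
Qed.

Lemma arc_pole t u : 0 < sin t ->
  Re (Ci * circle t * / (circle t + RtoC u))%C = - sin t * u / (u ^ 2 + 1 + 2 * cos t * u).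
Proof.
  intros Hs. pose proof (sin2_cos2 t) as S. unfold Rsqr in S.
  pose proof (ker_denominator (cos t) (- u) (Rabs_cos_lt t Hs)) as D.
  unfold circle, Re. simpl.
  set (c := cos t) in *. set (s := sin t) in *.
  set (d := u ^ 2 + 1 + 2 * c * u).
  assert (Hd : 0 < d) by (unfold d; lra).
  match goal with |- context [_ / ?e] => replace e with d end.
  2:{ unfold d. simpl. lra. }
  replace (u * (u * 1) + 1 + 2 * c * u) with d by (unfold d; ring).
  field. lra.
Qed.

Lemma arc_kernel t r x y : 0 < sin t ->
  Re (Ci * circle t * (RtoC r * omega y x (circle t)))%C =
  - (r * sin t * (ker (cos t) x + ker (- cos t) y)).
Proof.
  intros Hs. unfold omega.
  replace (Ci * circle t * (r * (/ (circle t + y) - / (circle t + RtoC (- x)))))%C with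
    (RtoC r * (Ci * circle t * / (circle t + y)) + RtoC (- r) * (Ci * circle t * / (circle t + RtoC (- x))))%C
    by (rewrite !RtoC_opp; ring).
  rewrite re_plus, !re_scal_l, !arc_pole by assumption. unfold ker.
  replace (y ^ 2 + 1 + 2 * cos t * y) with (y ^ 2 + 1 - 2 * - cos t * y) by ring.
  replace ((- x) ^ 2 + 1 + 2 * cos t * - x) with (x ^ 2 + 1 - 2 * cos t * x) by ring.
  unfold Rdiv. ring.
Qed.

Definition rho : C := (1 / 2, sqrt 3 / 2).
Definition rho2 : C := (- (1 / 2), sqrt 3 / 2).

Lemma rho2_H : upper_half rho2.
Proof. unfold upper_half, rho2; simpl. pose proof (sqrt_lt_R0 3). lra. Qed.

Lemma circle_rho : circle (PI / 3) = rho.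
Proof. unfold circle, rho. now rewrite cos_PI3, sin_PI3. Qed.

Lemma circle_rho2 : circle (2 * PI / 3) = rho2.
Proof.
  unfold circle, rho2. replace (2 * PI / 3) with (2 * (PI / 3)) by field.
  rewrite cos_2PI3, sin_2PI3. f_equal. field.
Qed.

(* Both letters move [rho2] to [rho], so each letter contributes an integral over
   the same arc of the unit circle. *)
Lemma cact_rho2 b : cact b rho2 = rho.
Proof.
  pose proof (upper_half_one_plus _ rho2_H) as N.
  assert (E : (rho2 + 1)%C = rho) by (unfold rho, rho2; apply injective_projections; simpl; lra).
  destruct b; unfold cact; [exact E|].
  assert (S : sqrt 3 * sqrt 3 = 3) by (apply sqrt_sqrt; lra).
  assert (M : (rho2 = rho * (rho2 + 1))%C).
  { rewrite E. unfold rho, rho2. apply injective_projections; simpl; lra. }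
  rewrite M at 1. field. exact N.
Qed.

Lemma arc_integral f y x G : holomorphic_on_H f -> real_nonneg_on_arc f -> primitive_of f y x G ->
  is_RInt (fun t => Phi f t * (ker (cos t) x + ker (- cos t) y)) (PI / 3) (2 * PI / 3)
    (Re (G rho - G rho2)%C).
Proof.
  intros Hf Hr HG. pose proof arc_bounds as AB.
  assert (H1 : forall t, Rmin (PI / 3) (2 * PI / 3) <= t <= Rmax (PI / 3) (2 * PI / 3) ->
    is_derive (V := C_R_NormedModule) (fun t => G (circle t)) t
      ((fun z => Ci * z * (f z * omega y x z))%C (circle t))).
  { rewrite Rmin_left, Rmax_right by lra. intros t Ht.
    apply (is_Cderive_curve G circle t (f (circle t) * omega y x (circle t))%C (Ci * circle t)%C).
    apply HG. now apply circle_H. apply circle_derive. }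
  assert (H2 : forall t, Rmin (PI / 3) (2 * PI / 3) <= t <= Rmax (PI / 3) (2 * PI / 3) ->
    continuous (U := C_R_NormedModule) (fun t => (fun z => Ci * z * (f z * omega y x z))%C (circle t)) t).
  { rewrite Rmin_left, Rmax_right by lra. intros t Ht.
    apply (Ccont_curve (fun z => Ci * z * (f z * omega y x z))%C).
    - destruct (holomorphic_mult _ _ holomorphic_rotate (holomorphic_mult _ _ Hf (holomorphic_omega y x)) _ (circle_H t Ht))
        as [l Hl]. exact (is_Cderive_cont _ _ _ Hl).
    - apply (ex_derive_continuous (V := C_R_NormedModule)). eexists. apply circle_derive. }
  pose proof (is_RInt_derive (V := C_R_CompleteNormedModule) _ _ _ _ H1 H2) as H.
  cbv beta in H. rewrite circle_rho, circle_rho2 in H.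
  apply (is_RInt_fct_extend_fst (U := R_NormedModule) (V := R_NormedModule)) in H.
  (* Increasing [t] leads from [rho] to [rho2], whereas a letter leads from [rho2] to [rho]; this
     sign compensates the one in [arc_kernel]. *)
  apply is_RInt_opp in H.
  replace (Re (G rho - G rho2)%C) with (opp (fst (minus (G rho2 : C_R_NormedModule) (G rho)))).
  2:{ change (- (fst (G rho2) + - fst (G rho)) = fst (G rho) + - fst (G rho2)). ring. }
  eapply is_RInt_ext; [|exact H].
  intros t. rewrite Rmin_left, Rmax_right by lra. intros Ht.
  assert (Hs : 0 < sin t) by (apply sin_gt_0; pose proof PI_RGT_0; lra).
  destruct (Hr t ltac:(lra)) as [I _]. unfold Phi.
  assert (Ef : f (circle t) = RtoC (Re (f (circle t)))).
  { apply injective_projections; [reflexivity|exact I]. }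
  pose proof (arc_kernel t (Re (f (circle t))) x y Hs) as K.
  rewrite <- Ef in K.
  match goal with |- _ = ?v =>
    change (- Re (Ci * circle t * (f (circle t) * omega y x (circle t)))%C = v) end.
  rewrite K. unfold circle. ring.
Qed.

Fixpoint KX (c : R) (L : list bool) (x : R) : R :=
  match L with
  | [] => 0
  | b :: L' => ker c (acts L x) + KX c L' x
  end.

(** The repelling orbit is met from the first letter on, and its point is read before the letter
    acts; [KX] reads the attracting orbit after the letter has acted. *)
Fixpoint KY (c : R) (L : list bool) (y : R) : R :=
  match L with
  | [] => 0
  | b :: L' => ker c y + KY c L' (act b y)
  end.

Lemma acts_app L M x : acts (L ++ M) x = acts L (acts M x).
Proof. apply fold_right_app. Qed.

Lemma KX_app c L M x : KX c (L ++ M) x = KX c L (acts M x) + KX c M x.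
Proof.
  induction L as [|b L IH]; cbn [KX app]; [ring|].
  rewrite IH, app_comm_cons, acts_app. ring.
Qed.

(** Both sums run over the same orbit and differ only in which end is counted; at a fixed point of
    the reversed word the correction vanishes. *)
Lemma KY_rev c L y : KY c L y = KX c (rev L) y + ker c y - ker c (acts (rev L) y).
Proof.
  revert y. induction L as [|b L IH]; intros y; cbn [KY rev]; [simpl; ring|].
  rewrite IH, KX_app, acts_app. simpl. ring.
Qed.

Lemma word_integral f L : holomorphic_on_H f -> SL2Z_letters f -> real_nonneg_on_arc f ->
  forall y x G, 0 < y -> 0 < x -> primitive_of f y (acts L x) G ->
  is_RInt (fun t => Phi f t * (KX (cos t) L x + KY (- cos t) L y)) (PI / 3) (2 * PI / 3)
    (Re (G (cacts L rho2) - G rho2)%C).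
Proof.
  intros Hf Hl Hr. induction L as [|b L IH]; intros y x G Hy Hx HG.
  - replace (Re (G (cacts [] rho2) - G rho2)%C) with ((2 * PI / 3 - PI / 3) * 0)
      by (unfold Re; simpl; ring).
    eapply is_RInt_ext; [|apply (is_RInt_const (V := R_NormedModule))]. intros t _. simpl. ring.
  - pose proof (arc_integral f y (acts (b :: L) x) G Hf Hr HG) as H1.
    (* The rest of the path, starting at [rho], is the image under [b] of the path for [L]; pulling
       the primitive back by [b] moves the poles to [- act b y] and [acts L x]. *)
    assert (H2 := IH (act b y) x (fun z => G (cact b z)) (act_pos b y Hy) Hx
      (primitive_of_act f b y _ G Hl Hy (acts_pos L x Hx) HG)).
    cbv beta in H2. rewrite cact_rho2 in H2.
    replace (Re (G (cacts (b :: L) rho2) - G rho2)%C) with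
      (plus (Re (G rho - G rho2)%C) (Re (G (cact b (cacts L rho2)) - G rho)%C)).
    2:{ change ((fst (G rho) + - fst (G rho2)) + (fst (G (cact b (cacts L rho2))) + - fst (G rho))
          = fst (G (cact b (cacts L rho2))) + - fst (G rho2)). ring. }
    eapply is_RInt_ext; [|apply (is_RInt_plus (V := R_NormedModule)); [exact H1|exact H2]].
    intros t _. unfold plus; cbn. ring.
Qed.

(* The cycle integral does not depend on the base point, since [G o A - G] has
   derivative zero; [rho2] is the convenient one. *)
Lemma segment_word_integral f L x y tau0 : holomorphic_on_H f -> SL2Z_letters f ->
  real_nonneg_on_arc f -> upper_half tau0 ->
  0 < y -> 0 < x -> acts L x = x -> acts (rev L) y = y ->
  is_RInt (fun t => Phi f t * (KX (cos t) L x + KX (- cos t) (rev L) y))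
    (PI / 3) (2 * PI / 3)
    (Re (segment_integral (fun z => f z * omega y x z)%C tau0 (cacts L tau0))).
Proof.
  intros Hf Hl Hr Ht Hy Hx Ex Ey.
  destruct (primitive_exists f y x Hf) as [G HG].
  assert (Hh : holomorphic_on_H (fun z => f z * omega y x z)%C) by (apply holomorphic_mult; auto using holomorphic_omega).
  assert (HG' : primitive_of f y x (fun z => G (cacts L z))).
  { rewrite <- Ey. apply primitive_of_acts; auto. now rewrite Ex. }
  pose proof (segment_integral_primitive _ _ tau0 rho2 Hh HG Ht rho2_H) as E1.
  pose proof (segment_integral_primitive _ _ tau0 rho2 Hh HG' Ht rho2_H) as E2.
  rewrite (segment_integral_primitive _ _ tau0 _ Hh HG Ht (cacts_H L _ Ht)).
  replace (G (cacts L tau0) - G tau0)%C with (G (cacts L rho2) - G rho2)%C.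
  2:{ rewrite E1 in E2.
      replace (G (cacts L tau0)) with (G (cacts L rho2) - (G (cacts L rho2) - G (cacts L tau0)))%C by ring.
      rewrite <- E2. ring. }
  assert (HG2 : primitive_of f y (acts L x) G) by now rewrite Ex.
  pose proof (word_integral f L Hf Hl Hr y x G Hy Hx HG2) as W.
  eapply is_RInt_ext; [|exact W].
  intros t _. match goal with |- ?a = ?b => change (a = b :> R) end.
  cbv beta. rewrite KY_rev, Ey. ring.
Qed.

(** * Fixed points and quadratic forms *)

(** Powers of T alone or of V alone are parabolic; a word containing both letters has positive
    off-diagonal entries and is hyperbolic. *)
Definition mixed (L : list bool) : Prop := In true L /\ In false L.

Lemma mixed_rev L : mixed L -> mixed (rev L).
Proof. intros [H1 H2]. split; apply -> in_rev; auto. Qed.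

Lemma word_mat_cons b L : word_mat (b :: L) = mat_mul (lmat b) (word_mat L).
Proof. reflexivity. Qed.

Lemma mat_mul_assoc A B C : mat_mul A (mat_mul B C) = mat_mul (mat_mul A B) C.
Proof.
  destruct A as [a1 a2 a3 a4], B as [b1 b2 b3 b4], C as [c1 c2 c3 c4].
  unfold mat_mul. cbn [m11 m12 m21 m22]. f_equal; ring.
Qed.

Lemma mat_mul_id_l A : mat_mul mat_id A = A.
Proof.
  destruct A as [a b c d]. unfold mat_mul, mat_id. cbn [m11 m12 m21 m22]. f_equal; ring.
Qed.

Lemma mat_mul_id_r A : mat_mul A mat_id = A.
Proof.
  destruct A as [a b c d]. unfold mat_mul, mat_id. cbn [m11 m12 m21 m22]. f_equal; ring.
Qed.

Lemma word_mat_app L M : word_mat (L ++ M) = mat_mul (word_mat L) (word_mat M).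
Proof.
  induction L as [|b L IH]; [now rewrite mat_mul_id_l|].
  change (word_mat ((b :: L) ++ M)) with (mat_mul (lmat b) (word_mat (L ++ M))).
  now rewrite IH, mat_mul_assoc, word_mat_cons.
Qed.

(* Reversing a word exchanges the diagonal entries; the two fixed points are
   accordingly [x] for the word and [-y], with [y] fixed by the reversed word. *)
Definition mat_flip (A : mat2) : mat2 := Mat (m22 A) (m12 A) (m21 A) (m11 A).

Lemma word_mat_rev L : word_mat (rev L) = mat_flip (word_mat L).
Proof.
  induction L as [|b L IH]; [reflexivity|].
  simpl rev. rewrite word_mat_app, IH, !word_mat_cons.
  change (word_mat []) with mat_id. rewrite mat_mul_id_r.
  destruct (word_mat L) as [p q r s]. rewrite lmat_mul.
  destruct b; unfold mat_mul, mat_flip, lmat, mat_T, mat_V; cbn [m11 m12 m21 m22]; f_equal; ring.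
Qed.

Lemma word_mat_entries L :
  (1 <= m11 (word_mat L) /\ 0 <= m12 (word_mat L) /\ 0 <= m21 (word_mat L) /\
   1 <= m22 (word_mat L))%Z.
Proof.
  induction L as [|b L IH]; [cbn; lia|].
  rewrite word_mat_cons. destruct (word_mat L) as [p q r s]. rewrite lmat_mul.
  destruct b; cbn [m11 m12 m21 m22] in *; lia.
Qed.

Lemma word_mat_mixed L : mixed L -> (1 <= m12 (word_mat L) /\ 1 <= m21 (word_mat L))%Z.
Proof.
  intros [H1 H2]. split.
  - clear H2. induction L as [|b L IH]; [destruct H1|].
    pose proof (word_mat_entries L) as E.
    rewrite word_mat_cons. destruct (word_mat L) as [p q r s]. rewrite lmat_mul.
    destruct b; cbn [m11 m12 m21 m22] in *; [lia|].
    apply IH. destruct H1; [discriminate|auto].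
  - clear H1. induction L as [|b L IH]; [destruct H2|].
    pose proof (word_mat_entries L) as E.
    rewrite word_mat_cons. destruct (word_mat L) as [p q r s]. rewrite lmat_mul.
    destruct b; cbn [m11 m12 m21 m22] in *; [|lia].
    apply IH. destruct H2; [discriminate|auto].
Qed.

Lemma acts_word L x : 0 < x -> acts L x = moebR (word_mat L) x.
Proof.
  intros Hx. induction L as [|b L IH].
  - unfold moebR; simpl. field.
  - rewrite word_mat_cons. simpl. rewrite IH.
    pose proof (word_mat_entries L) as E.
    destruct (word_mat L) as [p q r s]. rewrite lmat_mul. unfold moebR.
    cbn [m11 m12 m21 m22] in *. destruct E as [E1 [E2 [E3 E4]]].
    apply IZR_le in E1, E2, E3, E4.
    assert (0 < IZR r * x + IZR s) by nra.
    destruct b; cbn [m11 m12 m21 m22 act]; rewrite ?plus_IZR.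
    + field. lra.
    + field. nra.
Qed.

Section Hyperbolic.
Variables a b c d : Z.
Hypotheses (Ha : (1 <= a)%Z) (Hb : (1 <= b)%Z) (Hc : (1 <= c)%Z) (Hd : (1 <= d)%Z)
  (Hdet : (a * d - b * c = 1)%Z).

(** The roots of c u^2 + (d - a) u - b are [x] and [- y], and [lam] is the larger eigenvalue. The
    values of c u + d at the two roots are the eigenvalues, so the derivatives there are lam^-2 and
    lam^2. *)
Lemma fixed_points_exist : exists x y lam : R, 0 < x /\ 0 < y /\ 1 < lam /\
  IZR c * x + IZR d = lam /\ IZR d - IZR c * y = / lam /\
  IZR c * (x - y) = IZR a - IZR d /\ IZR c * (x * y) = IZR b.
Proof.
  assert (T : (3 <= a + d)%Z) by nia.
  assert (E : IZR a * IZR d - IZR b * IZR c = 1)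
    by (rewrite <- !mult_IZR, <- minus_IZR, Hdet; reflexivity).
  apply IZR_le in Ha, Hb, Hc, Hd, T. rewrite plus_IZR in T.
  set (A := IZR a) in *. set (B := IZR b) in *. set (C := IZR c) in *. set (D := IZR d) in *.
  set (s := sqrt ((A + D) * (A + D) - 4)).
  assert (Hs0 : 0 <= s) by apply sqrt_pos.
  assert (Hs : s * s = (A + D) * (A + D) - 4) by (apply sqrt_sqrt; nra).
  assert (Hs1 : 1 < s) by nra.
  assert (Hs2 : s < A + D) by nra.
  assert (Bp : 0 < B * C) by nra.
  assert (S1 : Rabs (A - D) < s) by (apply Rabs_def1; nra).
  apply Rabs_def2 in S1.
  exists ((A - D + s) / (2 * C)), ((D - A + s) / (2 * C)), ((A + D + s) / 2).
  repeat split.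
  - apply Rdiv_lt_0_compat; lra.
  - apply Rdiv_lt_0_compat; lra.
  - lra.
  - field; lra.
  - apply (Rmult_eq_reg_r ((A + D + s) / 2)); [|lra]. rewrite Rinv_l by lra.
    replace ((D - C * ((D - A + s) / (2 * C))) * ((A + D + s) / 2)) with
      (((A + D) * (A + D) - s * s) / 4) by (field; lra). rewrite Hs. field.
  - field; lra.
  - replace (C * ((A - D + s) / (2 * C) * ((D - A + s) / (2 * C)))) with
      ((s * s - (A - D) * (A - D)) / (4 * C)) by (field; lra).
    apply (Rmult_eq_reg_r (4 * C)); [|lra]. unfold Rdiv. rewrite Rmult_assoc, Rinv_l by lra.
    lra.
Qed.

Variables x y lam : R.
Hypotheses (Hx : 0 < x) (Hy : 0 < y) (Hlam : 1 < lam)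
  (Elam : IZR c * x + IZR d = lam) (Elam' : IZR d - IZR c * y = / lam)
  (Ediff : IZR c * (x - y) = IZR a - IZR d) (Eprod : IZR c * (x * y) = IZR b).

Let A := Mat a b c d.

Lemma moebR_derive u : IZR c * u + IZR d <> 0 ->
  Derive (moebR A) u = / (IZR c * u + IZR d) ^ 2.
Proof.
  intros Hu. apply is_derive_unique. unfold moebR, A; cbn [m11 m12 m21 m22].
  auto_derive; [exact Hu|].
  assert (E : IZR a * IZR d - IZR b * IZR c = 1)
    by (rewrite <- !mult_IZR, <- minus_IZR, Hdet; reflexivity).
  field_simplify; auto. f_equal. lra.
Qed.

Lemma fixed_point_iff u : fixed_point A u <-> u = x \/ u = - y.
Proof.
  assert (Cp : 1 <= IZR c) by (apply IZR_le; auto).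
  assert (L1 : 0 < / lam) by (apply Rinv_0_lt_compat; lra).
  assert (Fix : forall v, IZR c * v + IZR d <> 0 ->
    (moebR A v = v <-> (v - x) * (v + y) = 0)).
  { intros v Hv. unfold moebR, A; cbn [m11 m12 m21 m22].
    assert (Q : IZR a * v + IZR b - v * (IZR c * v + IZR d) = - (IZR c * ((v - x) * (v + y)))).
    { rewrite <- Eprod. replace (IZR a) with (IZR c * (x - y) + IZR d) by lra. ring. }
    split.
    - intros E. apply (Rmult_eq_reg_l (IZR c)); [|lra]. rewrite Rmult_0_r.
      assert (IZR a * v + IZR b = v * (IZR c * v + IZR d)).
      { rewrite <- E at 2. field. auto. } lra.
    - intros E. rewrite E in Q. apply (Rmult_eq_reg_r (IZR c * v + IZR d)); auto.
      unfold Rdiv. rewrite Rmult_assoc, Rinv_l by auto. lra. }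
  split.
  - intros [N E]. apply Fix in E; auto. apply Rmult_integral in E. destruct E; [left|right]; lra.
  - assert (Nx : IZR c * x + IZR d <> 0) by lra.
    assert (Ny : IZR c * - y + IZR d <> 0) by lra.
    intros [->| ->]; (split; [assumption|apply Fix; [assumption|ring]]).
Qed.

Lemma derive_x : Rabs (Derive (moebR A) x) < 1.
Proof.
  rewrite moebR_derive by lra. rewrite Elam. rewrite Rabs_right.
  - rewrite <- Rinv_1. apply Rinv_lt_contravar; nra.
  - left. apply Rinv_0_lt_compat. nra.
Qed.

Lemma derive_y : 1 < Rabs (Derive (moebR A) (- y)).
Proof.
  assert (L1 : 0 < / lam) by (apply Rinv_0_lt_compat; lra).
  replace (1) with (/ 1) by field.
  rewrite moebR_derive by lra. replace (IZR c * - y + IZR d) with (/ lam) by lra.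
  rewrite pow_inv, Rinv_inv, Rabs_right; nra.
Qed.

Lemma is_form_of_exists : exists Q, is_form_of A Q.
Proof.
  (* The fixed-point polynomial is negated before division by its content: the leading coefficient
     must have the sign of [- y - x], which is negative. *)
  set (g := Z.gcd (- c) (Z.gcd (a - d) b)).
  assert (Hg : (0 < g)%Z).
  { pose proof (Z.gcd_nonneg (- c) (Z.gcd (a - d) b)).
    assert (g <> 0)%Z by (unfold g; rewrite Z.gcd_eq_0; lia). lia. }
  destruct (Z.gcd_divide_l (- c) (Z.gcd (a - d) b)) as [p Hp]. fold g in Hp.
  destruct (Z.gcd_divide_r (- c) (Z.gcd (a - d) b)) as [h Hh]. fold g in Hh.
  destruct (Z.gcd_divide_l (a - d) b) as [q0 Hq].
  destruct (Z.gcd_divide_r (a - d) b) as [r0 Hr].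
  rewrite Hh in Hq, Hr.
  set (q := (q0 * h)%Z). set (r := (r0 * h)%Z).
  assert (Eq : (a - d = q * g)%Z) by (unfold q; lia).
  assert (Er : (b = r * g)%Z) by (unfold r; lia).
  exists (Form p q r). split.
  - unfold form_primitive; cbn [fa fb fc].
    apply (Z.mul_reg_l _ _ g); [lia|].
    rewrite <- Z.gcd_mul_mono_l_nonneg, <- Z.gcd_mul_mono_l_nonneg by lia.
    rewrite (Z.mul_comm g p), (Z.mul_comm g q), (Z.mul_comm g r), <- Hp, <- Eq, <- Er.
    fold g. lia.
  - exists (- y), x.
    assert (Rg : 0 < IZR g) by (apply IZR_lt; auto).
    assert (Rc : 1 <= IZR c) by (apply IZR_le; auto).
    assert (Ep : - IZR c = IZR p * IZR g) by (rewrite <- opp_IZR, <- mult_IZR; congruence).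
    assert (Eq' : IZR a - IZR d = IZR q * IZR g) by (rewrite <- minus_IZR, <- mult_IZR; congruence).
    assert (Er' : IZR b = IZR r * IZR g) by (rewrite <- mult_IZR; congruence).
    assert (F : forall u, IZR g * form_evalR (Form p q r) u 1 = - IZR c * ((u - x) * (u + y))).
    { intros u. unfold form_evalR; cbn [fa fb fc].
      replace (IZR g * _) with ((IZR p * IZR g) * u ^ 2 + (IZR q * IZR g) * u + IZR r * IZR g) by ring.
      rewrite <- Ep, <- Eq', <- Er', <- Ediff, <- Eprod. ring. }
    repeat split; try (apply fixed_point_iff; auto).
    + apply derive_y.
    + apply derive_x.
    + apply (Rmult_eq_reg_l (IZR g)); [|lra]. rewrite F. ring.
    + apply (Rmult_eq_reg_l (IZR g)); [|lra]. rewrite F. ring.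
    + cbn [fa]. rewrite !sign_eq_m1; nra.
Qed.

(** With leading coefficient p < 0, the form is p (z + y) (z - x) and the root of its discriminant
    is -p (x + y); p cancels in the quotient, which is the partial fraction [omega y x z]. *)
Lemma form_kernel Q z : is_form_of A Q -> upper_half z ->
  (RtoC (sqrt (IZR (form_disc Q))) / form_evalC Q z 1 = omega y x z)%C.
Proof.
  intros [_ [w [w' [[Hw1 Hw2] [[Hv1 Hv2] [R1 [R2 Hs]]]]]]] Hz.
  pose proof derive_x as Dx. pose proof derive_y as Dy.
  apply fixed_point_iff in Hw1. apply fixed_point_iff in Hv1.
  (* Exchanging the two fixed points would contradict the size of the derivative at each. *)
  assert (w = - y) by (destruct Hw1 as [E|E]; [subst w; lra|auto]).
  assert (w' = x) by (destruct Hv1 as [E|E]; [auto|subst w'; lra]).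
  subst w w'. clear Hw1 Hv1 Hw2 Hv2 Dx Dy.
  destruct Q as [p q r]. unfold form_evalR, form_evalC, form_disc in *. cbn [fa fb fc] in *.
  rewrite (sign_eq_m1 (- y - x)) in Hs by lra.
  assert (Hp : IZR p < 0).
  { destruct (Rlt_or_le (IZR p) 0) as [|N]; auto. exfalso.
    destruct N as [N|N]; [rewrite sign_eq_1 in Hs by auto|rewrite <- N, sign_0 in Hs]; lra. }
  assert (Eq : IZR q = - IZR p * (x - y)).
  { apply (Rmult_eq_reg_r (x + y)); [|lra]. lra. }
  assert (Er : IZR r = - IZR p * (x * y)) by (rewrite Eq in R2; lra).
  assert (ED : IZR (q ^ 2 - 4 * p * r) = (- IZR p * (x + y)) * (- IZR p * (x + y))).
  { replace (q ^ 2)%Z with (q * q)%Z by ring. rewrite minus_IZR, !mult_IZR, Eq, Er. ring. }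
  rewrite ED, sqrt_square by nra.
  unfold ZtoC. rewrite Eq, Er, !RtoC_mult, !RtoC_opp, RtoC_plus, RtoC_minus.
  unfold omega.
  assert (N1 := upper_half_neq1 z y Hz). assert (N2 := upper_half_neq1 z (- x) Hz).
  rewrite RtoC_opp in N2 |- *.
  assert (N3 : RtoC (IZR p) <> 0) by (intros X; apply RtoC_inj in X; lra).
  replace (RtoC (IZR p) * z ^ 2 + - RtoC (IZR p) * (RtoC x - RtoC y) * z * 1 + - RtoC (IZR p) * (RtoC x * RtoC y) * 1 ^ 2)%C
   with (RtoC (IZR p) * (z + RtoC y) * (z + - RtoC x))%C by ring.
  field. repeat split; auto.
Qed.

End Hyperbolic.

Lemma segment_integral_ext g1 g2 a b : upper_half a -> upper_half b ->
  (forall z, upper_half z -> g1 z = g2 z) -> segment_integral g1 a b = segment_integral g2 a b.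
Proof.
  intros Ha Hb H. unfold segment_integral.
  apply (RInt_ext (V := C_R_CompleteNormedModule)).
  rewrite Rmin_left, Rmax_right by lra. intros t Ht.
  rewrite H; [reflexivity|]. apply segment_H; auto; lra.
Qed.

Lemma cycle_integral_word f tau0 L : mixed L -> upper_half tau0 ->
  exists x y lam, 0 < x /\ 0 < y /\ acts L x = x /\ acts (rev L) y = y /\
  1 < lam /\ IZR (m21 (word_mat L)) * x + IZR (m22 (word_mat L)) = lam /\
  cycle_integral f tau0 (word_mat L) =
    segment_integral (fun z => f z * omega y x z)%C tau0 (cacts L tau0).
Proof.
  intros HL Ht.
  pose proof (word_mat_entries L) as E. pose proof (word_mat_mixed L HL) as M.
  pose proof (word_mat_det L) as D. unfold mat_det in D.
  pose proof (word_mat_rev L) as W.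
  pose proof (moebC_word L tau0 Ht) as MC.
  assert (AW := fun x => acts_word L x). assert (AR := fun x => acts_word (rev L) x).
  rewrite W in AR.
  unfold cycle_integral.
  destruct (word_mat L) as [a b c d]. unfold mat_flip in AR. cbn [m11 m12 m21 m22] in *.
  destruct E as [E1 [_ [_ E4]]]. destruct M as [M1 M2].
  destruct (fixed_points_exist a b c d E1 M1 M2 E4 D)
    as [x [y [lam [Hx [Hy [Hl [F1 [F2 [F3 F4]]]]]]]]].
  exists x, y, lam.
  assert (Cp : 1 <= IZR c) by (apply IZR_le; auto).
  assert (Ap : 1 <= IZR a) by (apply IZR_le; auto).
  assert (Dp : 1 <= IZR d) by (apply IZR_le; auto).
  repeat split; auto.
  - rewrite AW by auto. unfold moebR; cbn [m11 m12 m21 m22].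
    apply (Rmult_eq_reg_r (IZR c * x + IZR d)); [|nra].
    unfold Rdiv. rewrite Rmult_assoc, Rinv_l by nra. rewrite <- F4.
    replace (IZR a) with (IZR c * (x - y) + IZR d) by lra. ring.
  - rewrite AR by auto. unfold moebR; cbn [m11 m12 m21 m22].
    apply (Rmult_eq_reg_r (IZR c * y + IZR a)); [|nra].
    unfold Rdiv. rewrite Rmult_assoc, Rinv_l by nra. rewrite <- F4.
    replace (IZR a) with (IZR c * (x - y) + IZR d) by lra. ring.
  - destruct (excluded_middle_informative (hyperbolic (Mat a b c d))) as [_|N].
    2:{ exfalso. apply N. unfold hyperbolic; cbn [m11 m22]. nia. }
    rewrite MC. apply segment_integral_ext; auto using cacts_H.
    intros z Hz.
    assert (FQ : is_form_of (Mat a b c d) (form_of (Mat a b c d))).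
    { unfold form_of. apply epsilon_spec. exact (is_form_of_exists a b c d M1 M2 D x y lam Hx Hy Hl F1 F2 F3 F4). }
    rewrite <- (form_kernel a b c d M2 D x y lam Hx Hy Hl F1 F2 F3 F4 _ z FQ Hz).
    unfold Cdiv. ring.
Qed.

(** * Averages along periodic words *)

Lemma ker_den_ge c x : -1/2 <= c <= 1/2 -> 0 < x -> (x ^ 2 + 1) / 2 <= x ^ 2 + 1 - 2 * c * x.
Proof. intros Hc Hx. pose proof (pow2_ge_0 (x - 1)). nra. Qed.

Lemma ker_bounds c x : -1/2 <= c <= 1/2 -> 0 < x -> 0 <= ker c x <= 1.
Proof.
  intros Hc Hx. pose proof (ker_den_ge c x Hc Hx). pose proof (pow2_ge_0 (x - 1)).
  unfold ker. split.
  - apply Rdiv_le_0_compat; nra.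
  - apply Rle_div_l; nra.
Qed.

(** Cross-multiplication cancels the terms in [c] and leaves (x - y) (1 - x y) over the product of
    the denominators; each denominator loses at most a factor 2 against x^2 + 1, whence 4. *)
Lemma ker_lipschitz c x y : -1/2 <= c <= 1/2 -> 0 < x -> 0 < y ->
  Rabs (ker c x - ker c y) <= 4 * Rabs (x - y).
Proof.
  intros Hc Hx Hy. pose proof (ker_den_ge c x Hc Hx) as Dx. pose proof (ker_den_ge c y Hc Hy) as Dy.
  unfold ker. set (p := x ^ 2 + 1 - 2 * c * x) in *. set (q := y ^ 2 + 1 - 2 * c * y) in *.
  assert (Pp : 0 < p) by nra. assert (Pq : 0 < q) by nra.
  replace (x / p - y / q) with ((x - y) * ((1 - x * y) / (p * q))).
  2:{ unfold p, q in *. field. split; lra. }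
  rewrite Rabs_mult, Rmult_comm. apply Rmult_le_compat_r; [apply Rabs_pos|].
  assert (B : (x ^ 2 + 1) / 2 * ((y ^ 2 + 1) / 2) <= p * q) by (apply Rmult_le_compat; nra).
  assert (Ppq : 0 < p * q) by (apply Rmult_lt_0_compat; auto).
  rewrite Rabs_div by lra. rewrite (Rabs_right (p * q)) by lra.
  apply Rle_div_l; [lra|]. pose proof (pow2_ge_0 (x - y)).
  assert (0 < x * y) by (apply Rmult_lt_0_compat; auto).
  assert (0 < (x * y) * (x * y)) by nra.
  apply Rabs_le. split; nra.
Qed.

Lemma act_nonexpansive b x y : 0 < x -> 0 < y -> Rabs (act b x - act b y) <= Rabs (x - y).
Proof.
  intros Hx Hy. destruct b; simpl.
  - right. f_equal. ring.
  - replace (x / (x + 1) - y / (y + 1)) with ((x - y) * / ((x + 1) * (y + 1))) by (field; lra).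
    rewrite Rabs_mult. rewrite <- (Rmult_1_r (Rabs (x - y))) at 2.
    apply Rmult_le_compat_l; [apply Rabs_pos|].
    rewrite Rabs_right by (left; apply Rinv_0_lt_compat; nra).
    rewrite <- Rinv_1. apply Rinv_le_contravar; nra.
Qed.

Lemma acts_nonexpansive L x y : 0 < x -> 0 < y -> Rabs (acts L x - acts L y) <= Rabs (x - y).
Proof.
  intros Hx Hy. induction L as [|b L IH]; [simpl; lra|].
  eapply Rle_trans; [|exact IH]. apply act_nonexpansive; apply acts_pos; auto.
Qed.

Lemma KX_bounds c L x : -1/2 <= c <= 1/2 -> 0 < x -> 0 <= KX c L x <= INR (length L).
Proof.
  intros Hc Hx. induction L as [|b L IH]; [simpl; lra|].
  cbn [KX length]. rewrite S_INR.
  pose proof (ker_bounds c (acts (b :: L) x) Hc (acts_pos _ _ Hx)). lra.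
Qed.

Lemma KX_lipschitz c L x y : -1/2 <= c <= 1/2 -> 0 < x -> 0 < y ->
  Rabs (KX c L x - KX c L y) <= 4 * INR (length L) * Rabs (x - y).
Proof.
  intros Hc Hx Hy. induction L as [|b L IH].
  - simpl. rewrite Rminus_diag, Rabs_R0. pose proof (Rabs_pos (x - y)). lra.
  - cbn [KX length]. rewrite S_INR.
    pose proof (ker_lipschitz c (acts (b :: L) x) (acts (b :: L) y) Hc (acts_pos _ _ Hx) (acts_pos _ _ Hy)).
    pose proof (acts_nonexpansive (b :: L) x y Hx Hy).
    replace (ker c (acts (b :: L) x) + KX c L x - (ker c (acts (b :: L) y) + KX c L y))
      with ((ker c (acts (b :: L) x) - ker c (acts (b :: L) y)) + (KX c L x - KX c L y)) by ring.
    eapply Rle_trans; [apply Rabs_triang|]. lra.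
Qed.

(** Determinant 1 turns the difference into (u - x) / ((c u + d) (c x + d)). The factor at [x] is
    [lam > 1]; the factor at [u] is at least 1 for every positive [u], so the rate does not depend
    on [u]. *)
Lemma acts_contraction L x : mixed L -> 0 < x -> acts L x = x ->
  exists lam, 1 < lam /\ forall u, 0 < u -> Rabs (acts L u - x) <= Rabs (u - x) / lam.
Proof.
  intros HL Hx Ex.
  pose proof (word_mat_entries L) as E. pose proof (word_mat_mixed L HL) as M.
  pose proof (word_mat_det L) as D. unfold mat_det in D.
  assert (WA := fun v => acts_word L v).
  destruct (word_mat L) as [a b c d]. cbn [m11 m12 m21 m22] in *.
  destruct E as [E1 [_ [_ E4]]]. destruct M as [M1 M2].
  assert (Det : IZR a * IZR d - IZR b * IZR c = 1)
    by (rewrite <- !mult_IZR, <- minus_IZR, D; reflexivity).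
  apply IZR_le in E1, E4, M1, M2.
  set (lam := IZR c * x + IZR d).
  assert (Hl : 1 < lam) by (unfold lam; nra).
  exists lam. split; [exact Hl|]. intros u Hu.
  rewrite <- Ex at 1. rewrite !WA by auto. unfold moebR. cbn [m11 m12 m21 m22].
  assert (P1 : 1 <= IZR c * u + IZR d) by nra.
  fold lam.
  replace ((IZR a * x + IZR b) / lam) with ((IZR a * x + IZR b) / (IZR c * x + IZR d)) by reflexivity.
  replace ((IZR a * u + IZR b) / (IZR c * u + IZR d) - (IZR a * x + IZR b) / (IZR c * x + IZR d))
    with ((u - x) * / ((IZR c * u + IZR d) * lam)).
  2:{ unfold lam in *.
      replace (u - x) with ((IZR a * IZR d - IZR b * IZR c) * (u - x)) by (rewrite Det; ring).
      field. split; lra. }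
  rewrite Rabs_mult. unfold Rdiv. apply Rmult_le_compat_l; [apply Rabs_pos|].
  rewrite Rabs_right by (left; apply Rinv_0_lt_compat, Rmult_lt_0_compat; lra).
  apply Rinv_le_contravar; [lra|]. rewrite <- (Rmult_1_l lam) at 1.
  apply Rmult_le_compat_r; lra.
Qed.

Lemma fixed_point_unique L x u : mixed L -> 0 < x -> acts L x = x -> 0 < u -> acts L u = u ->
  u = x.
Proof.
  intros HL Hx Ex Hu Eu. destruct (acts_contraction L x HL Hx Ex) as [lam [Hl C]].
  specialize (C u Hu). rewrite Eu in C. apply Rle_div_r in C; [|lra].
  pose proof (Rabs_pos (u - x)) as A.
  destruct (Req_dec (u - x) 0) as [Z|Z]; [lra|].
  apply Rabs_pos_lt in Z. nra.
Qed.

(** One period brings every positive starting point into a bounded set; contraction can then start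
    with a uniform constant. *)
Lemma acts_bounded L : mixed L -> exists K, forall u, 0 < u -> acts L u <= K.
Proof.
  intros HL. exists (IZR (m11 (word_mat L)) + IZR (m12 (word_mat L))). intros u Hu.
  rewrite acts_word by auto.
  pose proof (word_mat_entries L) as E. pose proof (word_mat_mixed L HL) as M.
  destruct (word_mat L) as [a b c d]. unfold moebR. cbn [m11 m12 m21 m22] in *.
  destruct E as [E1 [_ [_ E4]]]. destruct M as [M1 M2].
  apply IZR_le in E1, E4, M1, M2.
  assert (IZR a * u <= IZR a * (IZR c * u)) by (apply Rmult_le_compat_l; nra).
  assert (0 < IZR b * (IZR c * u)) by (repeat apply Rmult_lt_0_compat; lra).
  apply Rle_div_l; nra.
Qed.

Definition wpow (k : nat) (L : list bool) : list bool := concat (repeat L k).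

Lemma wpow_S k L : wpow (S k) L = L ++ wpow k L.
Proof. reflexivity. Qed.

Lemma wpow_S_r k L : wpow (S k) L = wpow k L ++ L.
Proof.
  induction k as [|k IH]; [unfold wpow; simpl; now rewrite app_nil_r|].
  rewrite wpow_S, IH at 1. rewrite app_assoc. reflexivity.
Qed.

Lemma wpow_rev k L : rev (wpow k L) = wpow k (rev L).
Proof.
  induction k as [|k IH]; [reflexivity|].
  now rewrite wpow_S, rev_app_distr, IH, wpow_S_r.
Qed.

Lemma KX_wpow_fixed c k L x : acts L x = x ->
  KX c (wpow k L) x = INR k * KX c L x /\ acts (wpow k L) x = x.
Proof.
  intros Ex. induction k as [|k [IH1 IH2]]; [simpl; split; [ring|reflexivity]|].
  rewrite wpow_S, KX_app, acts_app, IH1, IH2, S_INR. split; [ring|exact Ex].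
Qed.

(** The orbit of [u] approaches [x] geometrically, so the Lipschitz errors form a convergent series.
    Uniformity in [u] is the purpose: [u] will be built from the fixed point of a prefix, which
    varies with its length. *)
Lemma KX_wpow_upper L x : mixed L -> 0 < x -> acts L x = x ->
  exists C, 0 <= C /\ forall c k u, -1/2 <= c <= 1/2 -> 0 < u ->
    KX c (wpow k L) u <= INR k * KX c L x + C.
Proof.
  intros HL Hx Ex.
  destruct (acts_contraction L x HL Hx Ex) as [lam [Hl Co]].
  destruct (acts_bounded L HL) as [K HK].
  assert (K0 : x <= K) by (rewrite <- Ex; auto).
  set (N := INR (length L)). assert (HN : 0 <= N) by apply pos_INR.
  assert (NK : 0 <= 4 * N * K) by (repeat apply Rmult_le_pos; lra).
  (* Sum of the geometric series with terms [4 * N * K / lam ^ k]. *)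
  set (M := 4 * N * K * lam / (lam - 1)).
  assert (HM : 0 <= M) by (apply Rdiv_le_0_compat; [apply Rmult_le_pos; lra|lra]).
  assert (PL : forall k, 0 < lam ^ k) by (intros; apply pow_lt; lra).
  exists (N + M). split; [lra|]. intros c k u Hc Hu.
  assert (D : forall k, Rabs (acts (wpow (S k) L) u - x) <= K / lam ^ k).
  { clear k. induction k as [|k IH].
    - rewrite wpow_S, acts_app. change (wpow 0 L) with (@nil bool).
      change (acts [] u) with u. simpl. unfold Rdiv. rewrite Rinv_1, Rmult_1_r.
      pose proof (HK u Hu). pose proof (acts_pos L u Hu). apply Rabs_le; lra.
    - rewrite wpow_S, acts_app.
      eapply Rle_trans; [apply Co; apply acts_pos; auto|].
      simpl. apply (Rle_div_l _ _ lam); [lra|].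
      replace (K / (lam * lam ^ k) * lam) with (K / lam ^ k); [exact IH|].
      field. split; [apply Rgt_not_eq, PL|lra]. }
  assert (E : forall k, KX c (wpow (S k) L) u <= INR (S k) * KX c L x + N + M * (1 - / lam ^ k)).
  { clear k. induction k as [|k IH].
    - rewrite wpow_S, KX_app. change (wpow 0 L) with (@nil bool).
      change (acts [] u) with u. change (KX c [] u) with 0.
      change (INR 1) with 1. change (lam ^ 0) with 1. rewrite Rinv_1.
      pose proof (KX_bounds c L u Hc Hu) as A1. pose proof (KX_bounds c L x Hc Hx).
      fold N in A1. lra.
    - rewrite wpow_S, KX_app.
      pose proof (KX_lipschitz c L (acts (wpow (S k) L) u) x Hc (acts_pos _ _ Hu) Hx) as Li.
      fold N in Li.
      apply Rabs_le_between in Li.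
      assert (A : 4 * N * Rabs (acts (wpow (S k) L) u - x) <= 4 * N * (K / lam ^ k))
        by (apply Rmult_le_compat_l; [lra|apply D]).
      rewrite (S_INR (S k)).
      assert (B : M * (1 - / lam ^ S k) - M * (1 - / lam ^ k) = 4 * N * (K / lam ^ k)).
      { unfold M. simpl. field. split; [apply Rgt_not_eq, PL|lra]. }
      lra. }
  destruct k as [|k]; [simpl; lra|].
  specialize (E k). assert (0 <= M * / lam ^ k)
    by (apply Rmult_le_pos; [lra|left; apply Rinv_0_lt_compat, PL]). lra.
Qed.

Definition prefix (L : list bool) (n : nat) : list bool :=
  wpow (n / length L) L ++ firstn (n mod length L) L.

Lemma mixed_app_l L M : mixed L -> mixed (L ++ M).
Proof. intros [H1 H2]; split; apply in_or_app; auto. Qed.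

Lemma cos_arc t : PI / 3 <= t <= 2 * PI / 3 -> -1/2 <= cos t <= 1/2.
Proof.
  intros Ht. pose proof PI_RGT_0.
  pose proof cos_PI3. pose proof cos_2PI3.
  replace (2 * (PI / 3)) with (2 * PI / 3) in * by field.
  split.
  - replace (-1/2) with (cos (2 * PI / 3)) by lra. apply cos_decr_1; lra.
  - rewrite <- H0. apply cos_decr_1; lra.
Qed.

Lemma Phi_nonneg f t : real_nonneg_on_arc f -> PI / 3 <= t <= 2 * PI / 3 -> 0 <= Phi f t.
Proof.
  intros Hr Ht. apply Rmult_le_pos; [apply Hr; auto|].
  left. exact (circle_H t Ht).
Qed.

Lemma Phi_integrable f : holomorphic_on_H f -> exists V, is_RInt (Phi f) (PI / 3) (2 * PI / 3) V.
Proof.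
  intros Hf. pose proof arc_bounds.
  apply (ex_RInt_continuous (V := R_CompleteNormedModule)).
  rewrite Rmin_left, Rmax_right by lra. intros t Ht. unfold Phi.
  apply (continuous_mult (K := R_AbsRing)).
  - apply (continuous_comp (U := R_UniformSpace) (V := C_R_NormedModule) (fun s => f (circle s)) fst).
    + apply Ccont_curve.
      * destruct (Hf _ (circle_H t Ht)) as [l Hl]. exact (is_Cderive_cont _ _ _ Hl).
      * apply (ex_derive_continuous (V := C_R_NormedModule)). eexists. apply circle_derive.
    + apply continuous_fst.
  - apply continuous_sin.
Qed.

Lemma mixed_fixed_points L : mixed L ->
  exists x y, 0 < x /\ 0 < y /\ acts L x = x /\ acts (rev L) y = y.
Proof.
  intros HL. assert (Hi : upper_half Ci) by (unfold upper_half; simpl; lra).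
  (* The function and the base point are dummies; only the two fixed points are extracted. *)
  destruct (cycle_integral_word (fun z => z) Ci L HL Hi)
    as [x [y [_ [Hx [Hy [Ex [Ey _]]]]]]].
  exists x, y. auto.
Qed.

(** * Cycle integrals of periodic words and their limit superior *)

Section Periodic.
Variables (f : C -> C) (tau0 : C).
Hypotheses (Hf : holomorphic_on_H f) (Hl : SL2Z_letters f) (Hr : real_nonneg_on_arc f)
  (Ht : upper_half tau0).

Lemma cycle_integral_value L x y : mixed L -> 0 < x -> 0 < y ->
  acts L x = x -> acts (rev L) y = y ->
  is_RInt (fun t => Phi f t * (KX (cos t) L x + KX (- cos t) (rev L) y)) (PI / 3) (2 * PI / 3)
    (Re (cycle_integral f tau0 (word_mat L))).
Proof.
  intros HL Hx Hy Ex Ey. destruct (cycle_integral_word f tau0 L HL Ht)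
    as [u [v [lam [Hu [Hv [Eu [Ev [_ [_ E]]]]]]]]].
  rewrite E, (fixed_point_unique L u x), (fixed_point_unique (rev L) v y)
    by auto using mixed_rev.
  now apply segment_word_integral.
Qed.

Lemma mixed_wpow L k : mixed L -> (1 <= k)%nat -> mixed (wpow k L).
Proof. intros HL Hk. destruct k; [lia|]. rewrite wpow_S. now apply mixed_app_l. Qed.

(** A power of a word has the same fixed points, so the orbit sums are simply repeated [k] times. *)
Lemma cycle_integral_wpow L k : mixed L -> (1 <= k)%nat ->
  Re (cycle_integral f tau0 (word_mat (wpow k L))) =
  INR k * Re (cycle_integral f tau0 (word_mat L)).
Proof.
  intros HL Hk. destruct (mixed_fixed_points L HL) as [x [y [Hx [Hy [Ex Ey]]]]].
  pose proof (cycle_integral_value L x y HL Hx Hy Ex Ey) as V1.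
  assert (V2 : is_RInt (fun t => Phi f t *
    (KX (cos t) (wpow k L) x + KX (- cos t) (rev (wpow k L)) y)) (PI / 3) (2 * PI / 3)
    (Re (cycle_integral f tau0 (word_mat (wpow k L))))).
  { apply cycle_integral_value; auto using mixed_wpow; rewrite ?wpow_rev.
    apply (KX_wpow_fixed 0 k L x Ex). apply (KX_wpow_fixed 0 k (rev L) y Ey). }
  apply (is_RInt_scal (V := R_NormedModule) _ _ _ (INR k)) in V1.
  apply (is_RInt_unique (V := R_CompleteNormedModule)) in V1.
  apply (is_RInt_unique (V := R_CompleteNormedModule)) in V2.
  change (scal (INR k) (Re (cycle_integral f tau0 (word_mat L))))
    with (INR k * Re (cycle_integral f tau0 (word_mat L))) in V1.
  rewrite <- V1, <- V2. apply (RInt_ext (V := R_CompleteNormedModule)). intros t _.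
  rewrite wpow_rev.
  rewrite (proj1 (KX_wpow_fixed _ k L x Ex)), (proj1 (KX_wpow_fixed _ k (rev L) y Ey)).
  unfold scal; simpl; unfold mult; simpl. ring.
Qed.

Lemma cycle_integral_nonneg L : mixed L -> 0 <= Re (cycle_integral f tau0 (word_mat L)).
Proof.
  intros HL. destruct (mixed_fixed_points L HL) as [x [y [Hx [Hy [Ex Ey]]]]].
  pose proof (cycle_integral_value L x y HL Hx Hy Ex Ey) as V.
  replace 0 with ((2 * PI / 3 - PI / 3) * 0) by ring.
  refine (is_RInt_le (fun _ => 0) _ (PI / 3) (2 * PI / 3) _ _ arc_bounds _ V _).
  - apply (is_RInt_const (V := R_NormedModule)).
  - intros t Ht'. apply Rmult_le_pos; [apply Phi_nonneg; auto; lra|].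
    pose proof (cos_arc t ltac:(lra)) as H.
    pose proof (KX_bounds (cos t) L x H Hx).
    pose proof (KX_bounds (- cos t) (rev L) y ltac:(lra) Hy). lra.
Qed.

Lemma cycle_integral_upper L : mixed L -> exists K, 0 <= K /\ forall k B, (1 <= k)%nat ->
  (length B <= length L)%nat ->
  Re (cycle_integral f tau0 (word_mat (wpow k L ++ B))) <=
  INR k * Re (cycle_integral f tau0 (word_mat L)) + K.
Proof.
  intros HL. pose proof arc_bounds as AB.
  destruct (mixed_fixed_points L HL) as [x [y [Hx [Hy [Ex Ey]]]]].
  pose proof (cycle_integral_value L x y HL Hx Hy Ex Ey) as IV.
  destruct (KX_wpow_upper L x HL Hx Ex) as [C1 [C1p B1]].
  destruct (KX_wpow_upper (rev L) y (mixed_rev L HL) Hy Ey) as [C2 [C2p B2]].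
  destruct (Phi_integrable f Hf) as [P HP].
  assert (P0 : 0 <= P).
  { replace 0 with ((2 * PI / 3 - PI / 3) * 0) by ring.
    refine (is_RInt_le (fun _ => 0) _ (PI / 3) (2 * PI / 3) _ _ AB _ HP _).
    apply (is_RInt_const (V := R_NormedModule)).
    intros t Ht'. apply Phi_nonneg; auto; lra. }
  (* [C1] and [C2] absorb the two orbits along the full periods; the incomplete period [B] costs at
     most 1 per letter in each orbit. *)
  set (M := C1 + C2 + 2 * INR (length L)).
  assert (M0 : 0 <= M) by (unfold M; pose proof (pos_INR (length L)); lra).
  exists (M * P). split; [apply Rmult_le_pos; auto|]. intros k B Hk HB.
  assert (MW : mixed (wpow k L ++ B)) by auto using mixed_app_l, mixed_wpow.
  destruct (mixed_fixed_points _ MW) as [u [v [Hu [Hv [Eu Ev]]]]].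
  pose proof (cycle_integral_value _ u v MW Hu Hv Eu Ev) as W.
  refine (is_RInt_le _ (fun t => INR k * (Phi f t * (KX (cos t) L x + KX (- cos t) (rev L) y))
      + M * Phi f t) (PI / 3) (2 * PI / 3) _ _ AB W _ _).
  - apply (is_RInt_plus (V := R_NormedModule));
      apply (is_RInt_scal (V := R_NormedModule)); auto.
  - intros t Ht'.
    pose proof (Phi_nonneg f t Hr ltac:(lra)) as Pt.
    pose proof (cos_arc t ltac:(lra)) as Hc.
    assert (Hc' : -1/2 <= - cos t <= 1/2) by lra.
    replace (INR k * (Phi f t * (KX (cos t) L x + KX (- cos t) (rev L) y)) + M * Phi f t)
      with (Phi f t * (INR k * KX (cos t) L x + INR k * KX (- cos t) (rev L) y + M)) by ring.
    apply Rmult_le_compat_l; [exact Pt|].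
    apply le_INR in HB.
    rewrite rev_app_distr, !KX_app, wpow_rev.
    pose proof (B1 (cos t) k (acts B u) Hc (acts_pos _ _ Hu)).
    pose proof (B2 (- cos t) k v Hc' Hv).
    pose proof (KX_bounds (cos t) B u Hc Hu).
    pose proof (KX_bounds (- cos t) (rev B) (acts (wpow k (rev L)) v) Hc' (acts_pos _ _ Hv)) as K4.
    rewrite length_rev in K4. unfold M. lra.
Qed.

Lemma mixed_length L : mixed L -> (0 < length L)%nat.
Proof. intros [H _]. destruct L; [destruct H|simpl; lia]. Qed.

Lemma cycle_integral_LimSup L : mixed L ->
  is_LimSup_seq (fun n => Re (cycle_integral f tau0 (word_mat (prefix L n))) / INR n)
    (Re (cycle_integral f tau0 (word_mat L)) / INR (length L)).
Proof.
  intros HL. pose proof (mixed_length L HL) as LP.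
  assert (HN : 0 < INR (length L)) by (apply lt_0_INR; auto).
  pose proof (cycle_integral_nonneg L HL) as V0.
  pose proof (cycle_integral_wpow L) as Eq.
  destruct (cycle_integral_upper L HL) as [K [K0 Up]].
  set (V := Re (cycle_integral f tau0 (word_mat L))) in *.
  intros eps. pose proof (cond_pos eps) as He. split.
  (* At a multiple of the period the quotient equals the average; [S n] keeps the number of periods
     positive. *)
  - intros n. exists (S n * length L)%nat. split; [nia|].
    unfold prefix. rewrite Nat.div_mul, Nat.Div0.mod_mul by lia. simpl firstn.
    rewrite app_nil_r, Eq by (auto; lia). rewrite mult_INR.
    assert (0 < INR (S n)) by (apply lt_0_INR; lia).
    replace (INR (S n) * V / (INR (S n) * INR (length L))) with (V / INR (length L))
      by (field; lra).
    lra.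
  - destruct (nfloor_ex (K / eps)) as [n0 [_ Hn0]].
    { apply Rdiv_le_0_compat; lra. }
    exists (S n0 + length L)%nat. intros n Hn.
    assert (Hk : (1 <= n / length L)%nat) by (apply Nat.div_le_lower_bound; lia).
    assert (HB : (length (firstn (n mod length L) L) <= length L)%nat)
      by (rewrite length_firstn; lia).
    pose proof (Up _ _ Hk HB) as U. fold (prefix L n) in U.
    assert (Hn' : INR n0 + 1 <= INR n) by (rewrite <- S_INR; apply le_INR; lia).
    assert (Hn1 : 0 < INR n) by (pose proof (pos_INR n0); lra).
    assert (D : INR (n / length L) * INR (length L) <= INR n).
    { rewrite <- mult_INR. apply le_INR. rewrite Nat.mul_comm. apply Nat.Div0.mul_div_le. }
    apply Rlt_div_l; [lra|].
    assert (KE : K < eps * INR n).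
    { apply Rlt_le_trans with (eps * (INR n0 + 1)); [|apply Rmult_le_compat_l; lra].
      apply (Rmult_lt_compat_l eps) in Hn0; [|lra].
      replace (eps * (K / eps)) with K in Hn0 by (field; lra). exact Hn0. }
    (* Dropping the incomplete period can only decrease the main term because [V] is nonnegative. *)
    assert (A : INR (n / length L) * V <= V / INR (length L) * INR n).
    { replace (INR (n / length L) * V) with (V / INR (length L) * (INR (n / length L) * INR (length L)))
        by (field; lra).
      apply Rmult_le_compat_l; [apply Rdiv_le_0_compat; lra|exact D]. }
    lra.
Qed.
End Periodic.

(** * Comparison of block words *)

(** The kernel depends on x only through x + 1/x, which is invariant under inversion and increasing
    for x >= 1; comparing kernel values thus becomes comparing points of the orbit moved above 1. *)
Definition trace (x : R) : R := x + / x.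
Definition hker (e s : R) : R := / (s - e).

Lemma ker_trace c x : -1/2 <= c <= 1/2 -> 0 < x -> ker c x = hker (2 * c) (trace x).
Proof.
  intros Hc Hx. pose proof (ker_den_ge c x Hc Hx).
  unfold ker, hker, trace. field. nra.
Qed.

Lemma trace_inv x : 0 < x -> trace (/ x) = trace x.
Proof. intros Hx. unfold trace. rewrite Rinv_inv. ring. Qed.

Lemma trace_le x y : 1 <= x -> x <= y -> trace x <= trace y.
Proof.
  intros Hx Hy. unfold trace.
  assert (E : y + / y - (x + / x) = (y - x) * (1 - / (x * y))) by (field; lra).
  assert (/ (x * y) <= 1) by (rewrite <- Rinv_1; apply Rinv_le_contravar; nra).
  assert (0 <= (y - x) * (1 - / (x * y))) by (apply Rmult_le_pos; lra). lra.
Qed.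

Lemma hker_le e s s' : e < s -> s <= s' -> hker e s' <= hker e s.
Proof. intros H1 H2. apply Rinv_le_contravar; lra. Qed.

Lemma phi_eq : phi * phi = phi + 1.
Proof. unfold phi. pose proof (sqrt_sqrt 5 ltac:(lra)). nra. Qed.

Lemma phi_bounds : 1.618 <= phi <= 1.6181.
Proof.
  pose proof phi_eq. assert (0 < phi) by (unfold phi; pose proof (sqrt_pos 5); lra).
  split; nra.
Qed.

Lemma sqrt2_bounds : sqrt 2 * sqrt 2 = 2 /\ 1.41421 <= sqrt 2 <= 1.41422.
Proof.
  pose proof (sqrt_sqrt 2 ltac:(lra)). pose proof (sqrt_pos 2). split; [auto|split; nra].
Qed.

Lemma trace_phi : trace phi = 2 * phi - 1.
Proof.
  pose proof phi_eq as E. pose proof phi_bounds. unfold trace.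
  assert (/ phi = phi - 1); [|lra].
  apply (Rmult_eq_reg_l phi); [|lra]. rewrite Rinv_r by lra. lra.
Qed.

Lemma trace_psi : trace psi = 2 * sqrt 2.
Proof.
  destruct sqrt2_bounds as [E B]. unfold trace, psi.
  assert (/ (1 + sqrt 2) = sqrt 2 - 1); [|lra].
  apply (Rmult_eq_reg_l (1 + sqrt 2)); [|lra]. rewrite Rinv_r by lra. lra.
Qed.

Lemma trace_sqrt2 : trace (sqrt 2) = 3 / 2 * sqrt 2.
Proof.
  destruct sqrt2_bounds as [E B]. unfold trace.
  assert (/ sqrt 2 = sqrt 2 / 2); [|lra].
  apply (Rmult_eq_reg_l (sqrt 2)); [|lra]. rewrite Rinv_r by lra. lra.
Qed.

Lemma inv_plus (a b : R) : a <> 0 -> b <> 0 -> / a + / b = (a + b) / (a * b).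
Proof. intros. field. auto. Qed.

Definition block (b : bool) : list bool :=
  if b then [true; true; false; false] else [true; false].

Definition block_map (b : bool) (x : R) : R :=
  if b then 2 + / (2 + / x) else 1 + / (1 + / x).

(** Kernel values along one block, the orbit points below 1 (those after a letter V) being replaced
    by their inverses. *)
Definition block_sum (e : R) (b : bool) (x : R) : R :=
  if b then hker e (trace (2 + / (2 + / x))) + hker e (trace (1 + / (2 + / x)))
          + hker e (trace (2 + / x)) + hker e (trace (1 + / x))
  else hker e (trace (1 + / (1 + / x))) + hker e (trace (1 + / x)).

Lemma acts_block b x : 0 < x -> acts (block b) x = block_map b x.
Proof.
  intros Hx. assert (0 < / x) by (apply Rinv_0_lt_compat; auto).
  destruct b; simpl; field; repeat split; lra.
Qed.

Lemma KX_block c b x : -1/2 <= c <= 1/2 -> 0 < x ->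
  KX c (block b) x = block_sum (2 * c) b x.
Proof.
  intros Hc Hx. assert (Hz : 0 < / x) by (apply Rinv_0_lt_compat; auto).
  assert (E1 : x / (x + 1) = / (1 + / x)) by (field; lra).
  assert (E2 : x / (x + 1) / (x / (x + 1) + 1) = / (2 + / x)) by (field; lra).
  assert (P1 : 0 < / (1 + / x)) by (apply Rinv_0_lt_compat; lra).
  assert (P2 : 0 < / (2 + / x)) by (apply Rinv_0_lt_compat; lra).
  destruct b; cbn [KX block block_sum acts fold_right act]; rewrite ?E2, E1.
  - rewrite !ker_trace by (auto; lra).
    rewrite (trace_inv (1 + / x)), (trace_inv (2 + / x)) by lra.
    replace (/ (2 + / x) + 1 + 1) with (2 + / (2 + / x)) by ring.
    replace (/ (2 + / x) + 1) with (1 + / (2 + / x)) by ring. ring.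
  - rewrite !ker_trace by (auto; lra).
    rewrite (trace_inv (1 + / x)) by lra.
    replace (/ (1 + / x) + 1) with (1 + / (1 + / x)) by ring. ring.
Qed.

(** * Upper and lower estimates for a single block on [phi, psi] *)

Section Estimates.
Variables (e X : R).
Hypotheses (He : -1 <= e <= 1) (HX : phi <= X <= psi).

Let z := / X.

Lemma z_bounds : sqrt 2 - 1 <= z <= phi - 1 /\ 0.41421 <= z <= 0.6181.
Proof.
  pose proof phi_eq. pose proof phi_bounds. destruct sqrt2_bounds as [E B].
  unfold psi in HX.
  assert (Z : z * X = 1) by (unfold z; field; lra).
  assert (0 < z) by (unfold z; apply Rinv_0_lt_compat; lra).
  assert (sqrt 2 - 1 <= z) by nra.
  assert (z <= phi - 1) by nra.
  lra.
Qed.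

Lemma inv_shift_bounds (n y lo hi : R) : 0 < n + lo -> lo <= y <= hi ->
  / (n + hi) <= / (n + y) <= / (n + lo).
Proof. intros H1 H2. split; apply Rinv_le_contravar; lra. Qed.

(** Both maps increase; the short one fixes [phi] and the long one fixes [psi], so only the opposite
    bound calls for a crude estimate. *)
Lemma block_map_range b : phi <= block_map b X <= psi.
Proof.
  pose proof phi_eq. pose proof phi_bounds. destruct sqrt2_bounds as [E B].
  destruct z_bounds as [[Z1 Z2] _]. unfold block_map. fold z.
  assert (I1 : / (1 + (phi - 1)) = phi - 1).
  { replace (1 + (phi - 1)) with phi by ring.
    apply (Rmult_eq_reg_l phi); [|lra]. rewrite Rinv_r by lra. lra. }
  assert (I2 : / (2 + (sqrt 2 - 1)) = sqrt 2 - 1).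
  { apply (Rmult_eq_reg_l (2 + (sqrt 2 - 1))); [|lra]. rewrite Rinv_r by lra. lra. }
  pose proof (inv_shift_bounds 1 z (sqrt 2 - 1) (phi - 1) ltac:(lra) (conj Z1 Z2)) as [A1 A2].
  pose proof (inv_shift_bounds 2 z (sqrt 2 - 1) (phi - 1) ltac:(lra) (conj Z1 Z2)) as [A3 A4].
  assert (A5 : / (1 + (sqrt 2 - 1)) <= 1).
  { rewrite <- Rinv_1. apply Rinv_le_contravar; lra. }
  assert (A6 : 0 < / (2 + (phi - 1))) by (apply Rinv_0_lt_compat; lra).
  unfold psi. destruct b; lra.
Qed.

(** The point [1 + / X] falls below [phi] as [X] grows, so its kernel value exceeds that of [phi] to
    first order; the decrease of the potential pays for it. With the other kernel value bounded by
    that at [phi], a coefficient of at least 1/(2 sqrt 5), about 0.224, is needed; it is attained at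
    [X = phi], [e = 1]. *)
Lemma upper_short : block_sum e false X <=
  2 * hker e (trace phi) + / 4 * hker e (trace phi) * (X - block_map false X).
Proof.
  pose proof phi_eq as EP. pose proof phi_bounds as BP. destruct z_bounds as [[Z1 Z2] [Z3 Z4]].
  pose proof (block_map_range false) as R. unfold block_sum. unfold block_map in *. fold z in R |- *.
  assert (A : hker e (trace (1 + / (1 + z))) <= hker e (trace phi)).
  { apply hker_le; [rewrite trace_phi; lra|]. apply trace_le; lra. }
  assert (B : hker e (trace (1 + z)) <=
    hker e (trace phi) + / 4 * hker e (trace phi) * (X - (1 + / (1 + z)))); [|lra].
  unfold hker. rewrite trace_phi.
  assert (S1 : 2 < trace (1 + z)).
  { apply Rlt_le_trans with (trace 1.41421); [unfold trace; lra|]. apply trace_le; lra. }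
  set (s := trace (1 + z)) in *.
  apply (Rmult_le_reg_r (s - e)); [lra|]. rewrite Rinv_l by lra.
  apply (Rmult_le_reg_l (2 * phi - 1 - e)); [lra|].
  replace ((2 * phi - 1 - e) * ((/ (2 * phi - 1 - e) + / 4 * / (2 * phi - 1 - e) * (X - (1 + / (1 + z)))) * (s - e)))
    with ((1 + / 4 * (X - (1 + / (1 + z)))) * (s - e)) by (field; lra).
  (* The worst case [e = 1]; for smaller [e] the right side gains the nonnegative term [D']. *)
  assert (K : 2 * phi - 1 - s <= / 4 * (X - (1 + / (1 + z))) * (s - 1)).
  { assert (PX : 0 < X) by lra.
    unfold s, trace, z.
    replace (X - (1 + / (1 + / X))) with ((X * X - X - 1) / (X + 1)) by (field; lra).
    replace (1 + / X + / (1 + / X) - 1) with ((X * X + X + 1) / (X * (X + 1))) by (field; lra).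
    replace (2 * phi - 1 - (1 + / X + / (1 + / X))) with
      (((2 * phi - 1) * (X * (X + 1)) - (X * X + (X + 1) * (X + 1))) / (X * (X + 1)))
      by (field; lra).
    replace (/ 4 * ((X * X - X - 1) / (X + 1)) * ((X * X + X + 1) / (X * (X + 1))))
      with ((/ 4 * ((X * X - X - 1) * (X * X + X + 1)) / (X + 1)) / (X * (X + 1))) by (field; lra).
    apply Rmult_le_compat_r; [left; apply Rinv_0_lt_compat; nra|].
    apply Rle_div_r; [lra|].
    (* Both sides vanish at [phi]. Extracting [X - phi] with [phi * phi = phi + 1] leaves a
       polynomial inequality with numerical slack. *)
    replace ((2 * phi - 1) * (X * (X + 1)) - (X * X + (X + 1) * (X + 1)))
      with ((X - phi) * ((2 * phi - 3) * (X + phi + 1))).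
    2:{ ring_simplify. replace (phi ^ 3) with (2 * phi + 1). replace (phi ^ 2) with (phi + 1). ring.
        simpl; lra. simpl. rewrite Rmult_1_r, EP, Rmult_plus_distr_l, EP. ring. }
    replace (X * X - X - 1) with ((X - phi) * (X + phi - 1)).
    2:{ ring_simplify. replace (phi ^ 2) with (phi + 1) by (simpl; lra). ring. }
    replace (/ 4 * ((X - phi) * (X + phi - 1) * (X * X + X + 1)))
      with ((X - phi) * (/ 4 * ((X + phi - 1) * (X * X + X + 1)))) by ring.
    rewrite Rmult_assoc. apply Rmult_le_compat_l; [lra|].
    apply Rle_trans with (0.2362 * (X + 2.6181) * (X + 1)).
    { apply Rmult_le_compat_r; [lra|]. apply Rmult_le_compat; lra. }
    apply Rle_trans with (/ 4 * ((X + 0.618) * (X * X + X + 1))).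
    2:{ apply Rmult_le_compat_l; [lra|]. apply Rmult_le_compat_r; [nra|lra]. }
    assert (X1 : 1.618 <= X) by lra. nra. }
  assert (D : 0 <= X - (1 + / (1 + z))).
  { replace (X - (1 + / (1 + z))) with ((X - phi) * (X + phi - 1) / (X + 1)).
    - apply Rdiv_le_0_compat; [apply Rmult_le_pos; lra|lra].
    - replace ((X - phi) * (X + phi - 1)) with (X * X - X - 1)
        by (ring_simplify; replace (phi ^ 2) with (phi + 1) by (simpl; lra); ring).
      unfold z. field. lra. }
  assert (D' : 0 <= / 4 * (X - (1 + / (1 + z))) * (1 - e)) by (repeat apply Rmult_le_pos; lra).
  lra.
Qed.

(** The kernel values of a long block fall short of the [phi] mean by a fixed amount, which covers
    the largest possible growth of the potential. *)
Lemma upper_long : block_sum e true X <=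
  4 * hker e (trace phi) + / 4 * hker e (trace phi) * (X - block_map true X).
Proof.
  pose proof phi_eq as EP. pose proof phi_bounds as BP. destruct z_bounds as [[Z1 Z2] [Z3 Z4]].
  destruct sqrt2_bounds as [E2 B2]. unfold psi in HX.
  unfold block_sum, block_map. fold z.
  assert (I : 0.3819 <= / (2 + z)).
  { assert (Y : / (2 + z) * (2 + z) = 1) by (field; lra). nra. }
  set (y := / (2 + z)) in *.
  assert (T1 : 2.8 <= trace (2 + y)).
  { apply Rle_trans with (trace 2.3819); [unfold trace; lra|apply trace_le; lra]. }
  assert (T2 : 2.105 <= trace (1 + y)).
  { apply Rle_trans with (trace 1.3819); [unfold trace; lra|apply trace_le; lra]. }
  assert (T3 : 2.8 <= trace (2 + z)).
  { apply Rle_trans with (trace 2.41421); [unfold trace; lra|apply trace_le; lra]. }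
  assert (T4 : 2.105 <= trace (1 + z)).
  { apply Rle_trans with (trace 1.41421); [unfold trace; lra|apply trace_le; lra]. }
  apply (hker_le e) in T1; [|lra]. apply (hker_le e) in T2; [|lra].
  apply (hker_le e) in T3; [|lra]. apply (hker_le e) in T4; [|lra].
  (* The potential grows most at [X = phi], where [X - (2 + y)] is about -0.764. *)
  assert (D : -0.765 <= X - (2 + y)).
  { assert (Y : y * (2 * X + 1) = X) by (unfold y, z; field; lra). nra. }
  (* 0.19125 is 0.765 / 4, and 2.2362 lies just above [trace phi], the square root of 5. The tight
     end is [e = -1], where these constants would allow a coefficient up to about 0.277 in place of
     1/4. *)
  assert (R : 2 * hker e 2.8 + 2 * hker e 2.105 <= (4 - 0.19125) * hker e (trace phi)).
  { apply Rle_trans with ((4 - 0.19125) * hker e 2.2362).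
    2:{ apply Rmult_le_compat_l; [lra|]. apply hker_le; rewrite trace_phi; lra. }
    unfold hker.
    rewrite <- Rmult_plus_distr_l, inv_plus by lra.
    set (u := 2.8 - e). set (v := 2.105 - e). set (w := 2.2362 - e).
    assert (Huv : 0 < u * v) by (apply Rmult_lt_0_compat; unfold u, v; lra).
    assert (Hw : 0 < w) by (unfold w; lra).
    replace (2 * ((u + v) / (u * v))) with (2 * (u + v) / (u * v)) by (unfold Rdiv; ring).
    apply (proj2 (Rle_div_l _ _ (u * v) Huv)).
    replace ((4 - 0.19125) * / w * (u * v)) with ((4 - 0.19125) * (u * v) / w) by (unfold Rdiv; ring).
    apply (proj1 (Rle_div_r _ _ w Hw)). unfold u, v, w. nra. }
  assert (0 < hker e (trace phi)) by (apply Rinv_0_lt_compat; rewrite trace_phi; lra).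
  nra.
Qed.

(* Steep enough to absorb the first-order defect of the long block at [psi], small
   enough for the slack of the short block; 1.5 lies between about 1.49 and 1.7. *)
Definition lower_slope : R := 1.5 * (hker e (trace psi) * hker e (trace (sqrt 2))).

(** A short block beats the [psi] mean by a fixed margin, so crude bounds on its two traces and on
    the change of the potential suffice. *)
Lemma lower_short : hker e (trace psi) + hker e (trace (sqrt 2)) +
  lower_slope * (/ block_map false X - / X) <= block_sum e false X.
Proof.
  pose proof phi_eq as EP. pose proof phi_bounds as BP. destruct z_bounds as [[Z1 Z2] [Z3 Z4]].
  destruct sqrt2_bounds as [E2 B2]. unfold psi in HX.
  unfold block_sum, block_map. fold z.
  assert (T1 : trace (1 + z) <= 2.2362).
  { apply Rle_trans with (trace phi); [apply trace_le; lra|rewrite trace_phi; lra]. }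
  assert (I : / (1 + z) <= 0.7072).
  { assert (Y : / (1 + z) * (1 + z) = 1) by (field; lra). nra. }
  assert (I0 : 0 < / (1 + z)) by (apply Rinv_0_lt_compat; lra).
  assert (T2 : trace (1 + / (1 + z)) <= 2.293).
  { apply Rle_trans with (trace 1.7072); [apply trace_le; lra|unfold trace; lra]. }
  assert (S1 : 2 <= trace (1 + z)).
  { apply Rle_trans with (trace 1); [unfold trace; lra|apply trace_le; lra]. }
  assert (S2 : 2 <= trace (1 + / (1 + z))).
  { apply Rle_trans with (trace 1); [unfold trace; lra|apply trace_le; lra]. }
  apply (hker_le e) in T1; [|lra]. apply (hker_le e) in T2; [|lra].
  (* The difference is largest at [X = psi], where it equals 3 - 2 sqrt 2, about 0.1716. *)
  assert (D : / (1 + / (1 + z)) - z <= 0.1717).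
  { assert (Y : / (1 + / (1 + z)) = (1 + z) / (2 + z)) by (field; lra).
    rewrite Y. apply Rminus_le. apply Rle_minus. apply Rle_minus_l.
    apply Rle_div_l; [lra|]. nra. }
  apply Rle_trans with (hker e 2.293 + hker e 2.2362); [|lra].
  unfold lower_slope. rewrite trace_psi, trace_sqrt2.
  assert (P1 : 0 < hker e (2 * sqrt 2)) by (apply Rinv_0_lt_compat; lra).
  assert (P2 : 0 < hker e (3 / 2 * sqrt 2)) by (apply Rinv_0_lt_compat; lra).
  apply Rle_trans with (hker e (2 * sqrt 2) + hker e (3 / 2 * sqrt 2) +
    1.5 * (hker e (2 * sqrt 2) * hker e (3 / 2 * sqrt 2)) * 0.1717).
  { apply Rplus_le_compat_l. apply Rmult_le_compat_l; [|exact D].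
    apply Rmult_le_pos; [lra|]. apply Rmult_le_pos; lra. }
  unfold hker. clear - He E2 B2. set (r := sqrt 2) in *.
  (* Since [r * r = 2], the product becomes linear in [r]; what remains is polynomial in [e] with
     tight numerical bounds on [r]. *)
  assert (Q : (2 * r - e) * (3 / 2 * r - e) = 6 - 3.5 * r * e + e * e) by nra.
  set (u := 2 * r - e) in *. set (v := 3 / 2 * r - e) in *.
  set (u' := 2.293 - e). set (v' := 2.2362 - e).
  assert (Hu : 0 < u) by (unfold u; lra). assert (Hv : 0 < v) by (unfold v; lra).
  assert (Hu' : 0 < u') by (unfold u'; lra). assert (Hv' : 0 < v') by (unfold v'; lra).
  assert (Huv : 0 < u * v) by (apply Rmult_lt_0_compat; auto).
  assert (Huv' : 0 < u' * v') by (apply Rmult_lt_0_compat; auto).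
  rewrite !inv_plus by lra. rewrite <- Rinv_mult.
  replace ((u + v) / (u * v) + 1.5 * / (u * v) * 0.1717) with ((u + v + 1.5 * 0.1717) / (u * v))
    by (unfold Rdiv; ring).
  apply (proj2 (Rle_div_l _ _ (u * v) Huv)). rewrite Q.
  match goal with |- _ <= ?n / ?d * ?m => replace (n / d * m) with (n * m / d)
    by (unfold Rdiv; ring) end.
  apply (proj1 (Rle_div_r _ _ (u' * v') Huv')). unfold u, v, u', v'. nra.
Qed.

(** Convexity puts the graph above its tangent at [s0], whose slope is minus the square of the value
    there. *)
Lemma hker_convex s0 s d : e < s0 -> s0 <= s -> s - s0 <= d ->
  hker e s0 - d * (hker e s0 * hker e s0) <= hker e s.
Proof.
  intros H0 H1 H2. unfold hker.
  assert (P0 : 0 < / (s0 - e)) by (apply Rinv_0_lt_compat; lra).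
  apply Rle_trans with (/ (s0 - e) - (s - s0) * (/ (s0 - e) * / (s0 - e))); [nra|].
  apply (Rmult_le_reg_r ((s0 - e) * (s0 - e) * (s - e))); [repeat apply Rmult_lt_0_compat; lra|].
  replace ((/ (s0 - e) - (s - s0) * (/ (s0 - e) * / (s0 - e))) * ((s0 - e) * (s0 - e) * (s - e)))
    with ((s0 - e - (s - s0)) * (s - e)) by (field; lra).
  replace (/ (s - e) * ((s0 - e) * (s0 - e) * (s - e))) with ((s0 - e) * (s0 - e)) by (field; lra).
  nra.
Qed.

(** The first two orbit points lie below [psi] and [sqrt 2] and are harmless. The last two lie above
    them, a defect of first order in [z - (sqrt 2 - 1)], estimated by tangents and paid by the
    potential. *)
Lemma lower_long : 2 * (hker e (trace psi) + hker e (trace (sqrt 2))) +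
  lower_slope * (/ block_map true X - / X) <= block_sum e true X.
Proof.
  pose proof phi_eq as EP. pose proof phi_bounds as BP. destruct z_bounds as [[Z1 Z2] [Z3 Z4]].
  destruct sqrt2_bounds as [E2 B2].
  pose proof (block_map_range true) as R. unfold block_sum, block_map in *.
  fold z in R |- *. unfold psi in R.
  assert (I0 : 0 < / (2 + z)) by (apply Rinv_0_lt_compat; lra).
  assert (S1 : 2 <= trace (2 + / (2 + z))).
  { apply Rle_trans with (trace 1); [unfold trace; lra|apply trace_le; lra]. }
  assert (S2 : 2 <= trace (1 + / (2 + z))).
  { apply Rle_trans with (trace 1); [unfold trace; lra|apply trace_le; lra]. }
  assert (A1 : hker e (trace psi) <= hker e (trace (2 + / (2 + z)))).
  { apply hker_le; [lra|]. apply trace_le; unfold psi; lra. }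
  assert (A2 : hker e (trace (sqrt 2)) <= hker e (trace (1 + / (2 + z)))).
  { apply hker_le; [lra|]. apply trace_le; lra. }
  (* The change of the potential over the block, zero exactly at [psi]; all defects are expressed as
     multiples of it. *)
  set (d := z - / (2 + / (2 + z))).
  assert (Ed : d = 2 * (z - (sqrt 2 - 1)) * (z + sqrt 2 + 1) / (5 + 2 * z)).
  { replace (2 * (z - (sqrt 2 - 1)) * (z + sqrt 2 + 1)) with (2 * (z * z + 2 * z - 1)).
    2:{ ring_simplify. replace (sqrt 2 ^ 2) with 2 by (simpl; lra). ring. }
    unfold d. field. lra. }
  (* The increase of the trace and [d] share the factor [z - (sqrt 2 - 1)], so only the cofactors
     have to be compared. *)
  assert (T : forall n a k, 1 <= n -> a = n + (sqrt 2 - 1) ->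
    0 <= k -> 1 - / ((n + z) * a) <= k * (2 * (z + sqrt 2 + 1) / (5 + 2 * z)) ->
    trace (n + z) - trace a <= k * d).
  { intros n a k Hn Ha Hk H. rewrite Ed. unfold trace.
    replace (n + z + / (n + z) - (a + / a)) with ((z - (sqrt 2 - 1)) * (1 - / ((n + z) * a))).
    2:{ rewrite Ha. field. lra. }
    replace (k * (2 * (z - (sqrt 2 - 1)) * (z + sqrt 2 + 1) / (5 + 2 * z))) with
      ((z - (sqrt 2 - 1)) * (k * (2 * (z + sqrt 2 + 1) / (5 + 2 * z)))) by (field; lra).
    apply Rmult_le_compat_l; lra. }
  assert (G : 0.97 <= 2 * (z + sqrt 2 + 1) / (5 + 2 * z)) by (apply (proj1 (Rle_div_r _ _ (5 + 2 * z) ltac:(lra))); lra).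
  assert (D0 : 0 <= d).
  { rewrite Ed. apply Rdiv_le_0_compat; [|lra]. apply Rmult_le_pos; lra. }
  assert (T1 : trace (2 + z) - trace psi <= 0.875 * d).
  { apply T; [lra|unfold psi; lra|lra|].
    assert (0.158 <= / ((2 + z) * psi)); [|lra].
    assert (Y : / ((2 + z) * psi) * ((2 + z) * psi) = 1) by (unfold psi; field; lra).
    assert ((2 + z) * psi <= 6.321) by (unfold psi; nra).
    assert (0 < / ((2 + z) * psi)) by (apply Rinv_0_lt_compat; unfold psi; nra). nra. }
  assert (T2 : trace (1 + z) - trace (sqrt 2) <= 0.585 * d).
  { apply T; [lra|lra|lra|].
    assert (0.4368 <= / ((1 + z) * sqrt 2)); [|lra].
    assert (Y : / ((1 + z) * sqrt 2) * ((1 + z) * sqrt 2) = 1) by (field; lra).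
    assert ((1 + z) * sqrt 2 <= 2.2884) by nra.
    assert (0 < / ((1 + z) * sqrt 2)) by (apply Rinv_0_lt_compat; nra). nra. }
  assert (C1 := hker_convex (trace psi) (trace (2 + z)) _ ltac:(rewrite trace_psi; lra)
    ltac:(apply trace_le; unfold psi; lra) T1).
  assert (C2 := hker_convex (trace (sqrt 2)) (trace (1 + z)) _ ltac:(rewrite trace_sqrt2; lra)
    ltac:(apply trace_le; lra) T2).
  (* 0.6 is a root of 1.5 t - 0.875 t^2 - 0.585 with t = P / Q, and the other root exceeds 1; on
     this range the gain from the potential dominates both tangent losses. *)
  assert (PQ : 0.6 * hker e (trace (sqrt 2)) <= hker e (trace psi) <= hker e (trace (sqrt 2))).
  { rewrite trace_psi, trace_sqrt2. unfold hker. split.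
    - apply (Rmult_le_reg_r (3 / 2 * sqrt 2 - e)); [lra|].
      rewrite Rmult_assoc, Rinv_l, Rmult_1_r by lra.
      replace (/ (2 * sqrt 2 - e) * (3 / 2 * sqrt 2 - e)) with ((3 / 2 * sqrt 2 - e) / (2 * sqrt 2 - e))
        by (unfold Rdiv; ring).
      apply (proj1 (Rle_div_r _ _ (2 * sqrt 2 - e) ltac:(lra))); lra.
    - apply Rinv_le_contravar; lra. }
  unfold lower_slope.
  set (P := hker e (trace psi)) in *. set (Q := hker e (trace (sqrt 2))) in *.
  replace (/ (2 + / (2 + z)) - z) with (- d) by (unfold d; ring).
  assert (Q0 : 0 <= (P - 0.6 * Q) * (Q - P)) by (apply Rmult_le_pos; lra).
  assert (Q1 : 0 <= Q) by lra.
  assert (Q2 : 0 <= (P - 0.6 * Q) * Q) by (apply Rmult_le_pos; lra).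
  assert (Q3 : 0 <= d * (1.5 * (P * Q) - 0.875 * (P * P) - 0.585 * (Q * Q)))
    by (apply Rmult_le_pos; [exact D0|nra]).
  lra.
Qed.
End Estimates.

(** * Telescoping along block words and the symmetry under reversal *)

Definition block_word (B : list bool) : list bool := flat_map block B.

Lemma acts_block_word_range B X : phi <= X <= psi -> phi <= acts (block_word B) X <= psi.
Proof.
  intros HX. induction B as [|b B IH]; [exact HX|].
  simpl. rewrite acts_app, acts_block by (pose proof phi_bounds; lra).
  now apply block_map_range.
Qed.

Lemma KX_block_word_upper c B X : -1/2 <= c <= 1/2 -> phi <= X <= psi ->
  KX c (block_word B) X <= INR (length (block_word B)) * hker (2 * c) (trace phi) +
    / 4 * hker (2 * c) (trace phi) * (X - acts (block_word B) X).
Proof.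
  intros Hc HX. assert (He : -1 <= 2 * c <= 1) by lra.
  induction B as [|b B IH].
  - simpl. lra.
  - simpl. pose proof (acts_block_word_range B X HX) as R. fold (block_word B).
    set (Y := acts (block_word B) X) in *.
    assert (HY : 0 < Y) by (pose proof phi_bounds; lra).
    rewrite KX_app, acts_app, length_app, plus_INR. fold Y.
    rewrite KX_block, acts_block by auto.
    destruct b.
    + pose proof (upper_long (2 * c) Y He R). simpl (INR (length (block true))). lra.
    + pose proof (upper_short (2 * c) Y He R). simpl (INR (length (block false))). lra.
Qed.

Lemma KX_block_word_lower c B X : -1/2 <= c <= 1/2 -> phi <= X <= psi ->
  INR (length (block_word B)) * ((hker (2 * c) (trace psi) + hker (2 * c) (trace (sqrt 2))) / 2) +
    lower_slope (2 * c) * (/ acts (block_word B) X - / X) <= KX c (block_word B) X.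
Proof.
  intros Hc HX. assert (He : -1 <= 2 * c <= 1) by lra.
  induction B as [|b B IH].
  - simpl. lra.
  - simpl. pose proof (acts_block_word_range B X HX) as R. fold (block_word B).
    set (Y := acts (block_word B) X) in *.
    assert (HY : 0 < Y) by (pose proof phi_bounds; lra).
    rewrite KX_app, acts_app, length_app, plus_INR. fold Y.
    rewrite KX_block, acts_block by auto.
    destruct b.
    + pose proof (lower_long (2 * c) Y He R). simpl (INR (length (block true))). lra.
    + pose proof (lower_short (2 * c) Y He R). simpl (INR (length (block false))). lra.
Qed.

Lemma block_map_phi : block_map false phi = phi.
Proof.
  pose proof phi_eq. pose proof phi_bounds. unfold block_map.
  replace (/ phi) with (phi - 1).
  replace (1 + (phi - 1)) with phi by ring.
  all: apply (Rmult_eq_reg_l phi); [|lra]; try rewrite Rinv_r by lra; try lra.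
  rewrite Rmult_plus_distr_l, Rinv_r by lra. lra.
Qed.

Lemma block_map_psi : block_map true psi = psi.
Proof.
  destruct sqrt2_bounds as [E B]. unfold block_map, psi.
  replace (/ (1 + sqrt 2)) with (sqrt 2 - 1).
  replace (2 + (sqrt 2 - 1)) with (1 + sqrt 2) by ring.
  all: apply (Rmult_eq_reg_l (1 + sqrt 2)); [|lra]; try rewrite Rmult_plus_distr_l;
    rewrite Rinv_r by lra; lra.
Qed.

Lemma block_word_mixed B : B <> [] -> mixed (block_word B).
Proof.
  intros HB. destruct B as [|b B]; [contradiction|].
  simpl. apply mixed_app_l. destruct b; split; simpl; auto.
Qed.

(* The word maps [phi, psi] into itself, so an endpoint separating [x] from this
   interval would not be moved closer to [x], against contraction. *)
Lemma block_fixed_range B x : B <> [] -> 0 < x -> acts (block_word B) x = x ->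
  phi <= x <= psi.
Proof.
  intros HB Hx Ex. pose proof phi_bounds as BP. destruct sqrt2_bounds as [_ B2].
  destruct (acts_contraction _ x (block_word_mixed B HB) Hx Ex) as [lam [Hl C]].
  assert (W : phi <= psi) by (unfold psi; lra).
  assert (D : forall u, 0 < u -> Rabs (u - x) <= Rabs (acts (block_word B) u - x) -> u = x).
  { intros u Hu H. pose proof (Rle_trans _ _ _ H (C u Hu)) as K.
    apply (proj2 (Rle_div_r _ _ lam ltac:(lra))) in K.
    destruct (Req_dec (u - x) 0) as [Z|Z]; [lra|]. apply Rabs_pos_lt in Z. nra. }
  split; apply Rnot_lt_le; intros H.
  - pose proof (acts_block_word_range B phi (conj (Rle_refl _) W)) as R.
    assert (E : phi = x); [|lra]. apply D; [lra|]. rewrite !Rabs_right; lra.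
  - pose proof (acts_block_word_range B psi (conj W (Rle_refl _))) as R.
    assert (E : psi = x); [|lra]. apply D; [unfold psi; lra|]. rewrite !Rabs_left; lra.
Qed.

Definition mean_phi (c : R) : R := hker (2 * c) (trace phi).
(** Up to inversion, the orbit along the period of [psi] alternates between [psi] and [sqrt 2]. *)
Definition mean_psi (c : R) : R := (hker (2 * c) (trace psi) + hker (2 * c) (trace (sqrt 2))) / 2.

Lemma KX_block_fixed_bounds c B x : -1/2 <= c <= 1/2 -> B <> [] -> 0 < x ->
  acts (block_word B) x = x ->
  INR (length (block_word B)) * mean_psi c <= KX c (block_word B) x <=
  INR (length (block_word B)) * mean_phi c.
Proof.
  intros Hc HB Hx Ex. pose proof (block_fixed_range B x HB Hx Ex) as R.
  pose proof (KX_block_word_upper c B x Hc R). pose proof (KX_block_word_lower c B x Hc R).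
  rewrite Ex in *. unfold mean_phi, mean_psi. lra.
Qed.

(** Inversion conjugates T into V, so exchanging the letters of a word inverts its orbit and leaves
    the kernel values unchanged. *)
Lemma act_negb b x : 0 < x -> act (negb b) x = / act b (/ x).
Proof. intros Hx. destruct b; simpl; field; lra. Qed.

Lemma acts_negb L x : 0 < x -> acts (map negb L) x = / acts L (/ x).
Proof.
  intros Hx. assert (Hi : 0 < / x) by (apply Rinv_0_lt_compat; auto).
  induction L as [|b L IH]; simpl; [now rewrite Rinv_inv|].
  pose proof (acts_pos L _ Hi).
  rewrite IH, act_negb, Rinv_inv by (apply Rinv_0_lt_compat; auto). reflexivity.
Qed.

Lemma ker_inv c x : -1/2 <= c <= 1/2 -> 0 < x -> ker c (/ x) = ker c x.
Proof.
  intros Hc Hx. rewrite !ker_trace, trace_inv by (auto; apply Rinv_0_lt_compat; auto).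
  reflexivity.
Qed.

Lemma KX_negb c L x : -1/2 <= c <= 1/2 -> 0 < x -> KX c (map negb L) x = KX c L (/ x).
Proof.
  intros Hc Hx. assert (Hi : 0 < / x) by (apply Rinv_0_lt_compat; auto).
  induction L as [|b L IH]; [reflexivity|].
  cbn [map KX]. rewrite IH. f_equal.
  change (negb b :: map negb L) with (map negb (b :: L)).
  rewrite acts_negb by auto. apply ker_inv; auto using acts_pos.
Qed.

(** Each block has as many T as V, so reversing it equals exchanging its letters. The repelling
    orbit is thereby the inverse of an attracting orbit of the block word with blocks in reverse
    order. *)
Lemma rev_block_word B : rev (block_word B) = map negb (block_word (rev B)).
Proof.
  induction B as [|b B IH]; [reflexivity|].
  simpl. rewrite rev_app_distr. unfold block_word at 2. rewrite flat_map_app, map_app.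
  fold (block_word B) (block_word (rev B)). rewrite IH. f_equal. destruct b; reflexivity.
Qed.

Lemma length_rev_block_word B : length (block_word (rev B)) = length (block_word B).
Proof. now rewrite <- (length_rev (block_word B)), rev_block_word, length_map. Qed.

Lemma KX_rev_block_fixed_bounds c B y : -1/2 <= c <= 1/2 -> B <> [] -> 0 < y ->
  acts (rev (block_word B)) y = y ->
  INR (length (block_word B)) * mean_psi c <= KX c (rev (block_word B)) y <=
  INR (length (block_word B)) * mean_phi c.
Proof.
  intros Hc HB Hy Ey. assert (Hi : 0 < / y) by (apply Rinv_0_lt_compat; auto).
  assert (HB' : rev B <> []).
  { intros E. apply HB. rewrite <- (rev_involutive B), E. reflexivity. }
  rewrite rev_block_word in *. rewrite acts_negb in Ey by auto.
  rewrite KX_negb, <- length_rev_block_word by auto.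
  apply KX_block_fixed_bounds; auto. rewrite <- Ey at 2. now rewrite Rinv_inv.
Qed.

Lemma KX_phi c : -1/2 <= c <= 1/2 -> KX c (block_word [false]) phi = 2 * mean_phi c.
Proof.
  intros Hc. pose proof phi_bounds. unfold block_word, flat_map. rewrite app_nil_r.
  rewrite KX_block by (auto; lra). unfold block_sum, mean_phi.
  assert (E : 1 + / phi = phi).
  { apply (Rmult_eq_reg_l phi); [|lra]. rewrite Rmult_plus_distr_l, Rinv_r by lra.
    pose proof phi_eq. lra. }
  rewrite !E. ring.
Qed.

Lemma KX_psi c : -1/2 <= c <= 1/2 -> KX c (block_word [true]) psi = 4 * mean_psi c.
Proof.
  intros Hc. destruct sqrt2_bounds as [E2 B2]. unfold block_word, flat_map. rewrite app_nil_r.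
  assert (P : 0 < psi) by (unfold psi; lra).
  rewrite KX_block by auto. unfold block_sum, mean_psi.
  assert (E : / psi = sqrt 2 - 1).
  { apply (Rmult_eq_reg_l psi); [|lra]. rewrite Rinv_r by lra. unfold psi. lra. }
  assert (E1 : 2 + / psi = psi) by (rewrite E; unfold psi; ring).
  rewrite !E1. replace (1 + / psi) with (sqrt 2) by (rewrite E; ring). field.
Qed.

Lemma acts_phi : acts (block_word [false]) phi = phi.
Proof.
  unfold block_word, flat_map. rewrite app_nil_r, acts_block by (pose proof phi_bounds; lra).
  apply block_map_phi.
Qed.

Lemma acts_psi : acts (block_word [true]) psi = psi.
Proof.
  unfold block_word, flat_map.
  rewrite app_nil_r, acts_block by (pose proof sqrt2_bounds; unfold psi; lra).
  apply block_map_psi.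
Qed.

Lemma rev_single_word b x : 0 < x -> acts (block_word [b]) x = x ->
  acts (rev (block_word [b])) (/ x) = / x.
Proof.
  intros Hx E. rewrite rev_block_word. simpl rev.
  rewrite acts_negb by (apply Rinv_0_lt_compat; auto). now rewrite Rinv_inv, E.
Qed.

Lemma KX_rev_single c b x : -1/2 <= c <= 1/2 -> 0 < x ->
  KX c (rev (block_word [b])) (/ x) = KX c (block_word [b]) x.
Proof.
  intros Hc Hx. rewrite rev_block_word. simpl rev.
  rewrite KX_negb by (auto; apply Rinv_0_lt_compat; auto). now rewrite Rinv_inv.
Qed.

(** * Comparison of averages over one period *)

Section Averages.
Variables (f : C -> C) (tau0 : C).
Hypotheses (Hf : holomorphic_on_H f) (Hl : SL2Z_letters f) (Hr : real_nonneg_on_arc f)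
  (Ht : upper_half tau0).

Let average (B : list bool) : R :=
  Re (cycle_integral f tau0 (word_mat (block_word B))) / INR (length (block_word B)).

Lemma average_le B1 B2 x1 y1 x2 y2 :
  B1 <> [] -> B2 <> [] -> 0 < x1 -> 0 < y1 -> 0 < x2 -> 0 < y2 ->
  acts (block_word B1) x1 = x1 -> acts (rev (block_word B1)) y1 = y1 ->
  acts (block_word B2) x2 = x2 -> acts (rev (block_word B2)) y2 = y2 ->
  (forall c, -1/2 <= c <= 1/2 ->
    KX c (block_word B1) x1 * INR (length (block_word B2)) <=
      KX c (block_word B2) x2 * INR (length (block_word B1)) /\
    KX c (rev (block_word B1)) y1 * INR (length (block_word B2)) <=
      KX c (rev (block_word B2)) y2 * INR (length (block_word B1))) ->
  average B1 <= average B2.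
Proof.
  intros HB1 HB2 Hx1 Hy1 Hx2 Hy2 Ex1 Ey1 Ex2 Ey2 H.
  pose proof (block_word_mixed B1 HB1) as M1. pose proof (block_word_mixed B2 HB2) as M2.
  pose proof (cycle_integral_value f tau0 Hf Hl Hr Ht _ x1 y1 M1 Hx1 Hy1 Ex1 Ey1) as V1.
  pose proof (cycle_integral_value f tau0 Hf Hl Hr Ht _ x2 y2 M2 Hx2 Hy2 Ex2 Ey2) as V2.
  assert (N1 : 0 < INR (length (block_word B1))) by (apply lt_0_INR, mixed_length; auto).
  assert (N2 : 0 < INR (length (block_word B2))) by (apply lt_0_INR, mixed_length; auto).
  unfold average.
  set (n1 := INR (length (block_word B1))) in *. set (n2 := INR (length (block_word B2))) in *.
  apply (is_RInt_scal (V := R_NormedModule) _ _ _ (/ n1)) in V1.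
  apply (is_RInt_scal (V := R_NormedModule) _ _ _ (/ n2)) in V2.
  unfold Rdiv. rewrite !(Rmult_comm (Re _)).
  refine (is_RInt_le _ _ _ _ _ _ arc_bounds V1 V2 _).
  intros t Ht'.
  pose proof (cos_arc t ltac:(lra)) as Hc.
  (* The attracting orbit enters with [cos t] and the repelling one with [- cos t]; the range of [c]
     is symmetric. *)
  destruct (H (cos t) Hc) as [A _]. destruct (H (- cos t) ltac:(lra)) as [_ A'].
  pose proof (Phi_nonneg f t Hr ltac:(lra)) as Pt.
  apply (Rmult_le_reg_r (n1 * n2)); [apply Rmult_lt_0_compat; auto|].
  unfold scal; simpl; unfold mult; simpl.
  match goal with |- / n1 * (?p * ?q) * _ <= / n2 * (?p * ?q') * _ =>
    replace (/ n1 * (p * q) * (n1 * n2)) with (p * (q * n2)) by (field; lra);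
    replace (/ n2 * (p * q') * (n1 * n2)) with (p * (q' * n1)) by (field; lra) end.
  apply Rmult_le_compat_l; lra.
Qed.

Lemma average_bounds B : B <> [] -> average [true] <= average B <= average [false].
Proof.
  intros HB. pose proof phi_bounds. destruct sqrt2_bounds as [E2 B2].
  assert (Hphi : 0 < phi) by lra. assert (Hpsi : 0 < psi) by (unfold psi; lra).
  assert (NT : [true] <> []) by discriminate. assert (NF : [false] <> []) by discriminate.
  destruct (mixed_fixed_points _ (block_word_mixed B HB)) as [x [y [Hx [Hy [Ex Ey]]]]].
  split.
  - apply (average_le [true] B psi (/ psi) x y); auto using Rinv_0_lt_compat, acts_psi.
    { apply rev_single_word; auto using acts_psi. }
    intros c Hc. rewrite KX_rev_single, KX_psi by auto.
    change (INR (length (block_word [true]))) with (1 + 1 + 1 + 1).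
    pose proof (KX_block_fixed_bounds c B x Hc HB Hx Ex).
    pose proof (KX_rev_block_fixed_bounds c B y Hc HB Hy Ey). lra.
  - apply (average_le B [false] x y phi (/ phi)); auto using Rinv_0_lt_compat, acts_phi.
    { apply rev_single_word; auto using acts_phi. }
    intros c Hc. rewrite KX_rev_single, KX_phi by auto.
    change (INR (length (block_word [false]))) with (1 + 1).
    pose proof (KX_block_fixed_bounds c B x Hc HB Hx Ex).
    pose proof (KX_rev_block_fixed_bounds c B y Hc HB Hy Ey). lra.
Qed.
End Averages.

(** * Continued fraction digits *)

Definition block_digits (B : list bool) : list Z :=
  flat_map (fun b : bool => if b then [2; 2]%Z else [1; 1]%Z) B.

(** The invariant carried through the Markov recursion: the digits are a repetition of pairs 1,1 and
    2,2. *)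
Definition cf_blocks (B : list bool) (x : R) : Prop :=
  B <> [] /\ forall n, cf_digit x n = nth (n mod length (block_digits B)) (block_digits B) 0%Z.

Lemma length_block_digits B : length (block_digits B) = (2 * length B)%nat.
Proof. induction B as [|[] B IH]; simpl in *; lia. Qed.

Lemma block_digits_nth B i : (i < length B)%nat ->
  nth (2 * i) (block_digits B) 0%Z = (if nth i B false then 2 else 1)%Z /\
  nth (2 * i + 1) (block_digits B) 0%Z = (if nth i B false then 2 else 1)%Z.
Proof.
  revert i. induction B as [|b B IH]; intros i Hi; [simpl in Hi; lia|].
  destruct i as [|i]; [destruct b; simpl; auto|].
  simpl in Hi. specialize (IH i ltac:(lia)).
  replace (2 * S i + 1)%nat with (S (S (2 * i + 1))) by lia.
  replace (2 * S i)%nat with (S (S (2 * i))) by lia.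
  destruct b; exact IH.
Qed.

Lemma cf_blocks_paired B x : cf_blocks B x -> forall i,
  exists b : bool, cf_digit x (2 * i) = (if b then 2 else 1)%Z /\
    cf_digit x (2 * i + 1) = (if b then 2 else 1)%Z.
Proof.
  intros [HB H] i.
  assert (LB : (0 < length B)%nat) by (destruct B; [contradiction|simpl; lia]).
  exists (nth (i mod length B) B false). rewrite !H, length_block_digits.
  assert (Hi : (i mod length B < length B)%nat) by (apply Nat.mod_upper_bound; lia).
  rewrite Nat.Div0.mul_mod_distr_l, Nat.Div0.add_mul_mod_distr_l by lia.
  now apply block_digits_nth.
Qed.

Lemma paired_list_blocks (l : list Z) : Nat.Even (length l) ->
  (forall i, (2 * i + 1 < length l)%nat -> exists b : bool,
    nth (2 * i) l 0%Z = (if b then 2 else 1)%Z /\ nth (2 * i + 1) l 0%Z = (if b then 2 else 1)%Z) ->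
  exists B, l = block_digits B.
Proof.
  intros [k Hk]. revert l Hk. induction k as [|k IH]; intros l Hk H.
  - exists []. destruct l; [reflexivity|simpl in Hk; lia].
  - destruct l as [|p [|q l]]; simpl in Hk; try lia.
    destruct (H 0%nat) as [b [E1 E2]]; [simpl; lia|]. simpl in E1, E2. subst p q.
    destruct (IH l) as [B ->]; [lia| |].
    + intros i Hi. destruct (H (S i)) as [b' Hb']; [simpl; lia|].
      replace (2 * S i + 1)%nat with (S (S (2 * i + 1))) in Hb' by lia.
      replace (2 * S i)%nat with (S (S (2 * i))) in Hb' by lia.
      exists b'. exact Hb'.
    + exists (b :: B). destruct b; reflexivity.
Qed.

(** Digits at positions 2i and 2i + 1 agree whichever list describes the expansion, so an even
    period, read from position 0, is again cut at block boundaries. The lists chosen in a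
    conjunction can therefore be concatenated as block lists. *)
Lemma period_blocks B x l : cf_blocks B x -> purely_periodic l x -> Nat.Even (length l) ->
  exists B', B' <> [] /\ l = block_digits B'.
Proof.
  intros HB [Hne [_ [_ Hd]]] He.
  destruct (paired_list_blocks l He) as [B' E].
  - intros i Hi. destruct (cf_blocks_paired B x HB i) as [b Hb]. exists b.
    rewrite !Hd, !Nat.mod_small in Hb by lia. exact Hb.
  - exists B'. split; [|exact E]. intros ->. apply Hne. exact E.
Qed.

Lemma block_digits_app B B' : block_digits (B ++ B') = block_digits B ++ block_digits B'.
Proof. apply flat_map_app. Qed.

Lemma cf_tail_fixed x a : (IZR a <= x < IZR a + 1) -> / (x - IZR a) = x ->
  forall n, cf_digit x n = a.
Proof.
  intros Ha Hx.
  assert (T : forall n, cf_tail x n = x).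
  { induction n as [|n IH]; [reflexivity|].
    simpl. now rewrite IH, (Zfloor_eq a x Ha). }
  intros n. unfold cf_digit. rewrite T. now apply Zfloor_eq.
Qed.

Lemma cf_blocks_phi : cf_blocks [false] phi.
Proof.
  split; [discriminate|]. intros n. pose proof phi_bounds. pose proof phi_eq.
  rewrite (cf_tail_fixed phi 1); [|lra|].
  - assert (L : (n mod 2 < 2)%nat) by (apply Nat.mod_upper_bound; lia).
    change (length (block_digits [false])) with 2%nat.
    destruct (n mod 2) as [|[|k]]; [reflexivity|reflexivity|lia].
  - apply (Rmult_eq_reg_l (phi - 1)); [|lra]. rewrite Rinv_r by lra. lra.
Qed.

Lemma cf_blocks_psi : cf_blocks [true] psi.
Proof.
  split; [discriminate|]. intros n. destruct sqrt2_bounds.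
  rewrite (cf_tail_fixed psi 2); [|unfold psi; lra|].
  - assert (L : (n mod 2 < 2)%nat) by (apply Nat.mod_upper_bound; lia).
    change (length (block_digits [true])) with 2%nat.
    destruct (n mod 2) as [|[|k]]; [reflexivity|reflexivity|lia].
  - unfold psi. apply (Rmult_eq_reg_l (1 + sqrt 2 - 2)); [|lra]. rewrite Rinv_r by lra. lra.
Qed.

Lemma markov_blocks a b x : markov_map a b x -> exists B, cf_blocks B x.
Proof.
  induction 1 as [| |a b c d x y z _ _ [Bx Hx] _ [By Hy] [l [m [Hl [Hm Hz]]]]].
  - exists [false]. apply cf_blocks_phi.
  - exists [true]. apply cf_blocks_psi.
  - destruct Hl as [Pl [El _]]. destruct Hm as [Pm [Em _]].
    destruct (period_blocks By y l Hy Pl El) as [B1 [N1 ->]].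
    destruct (period_blocks Bx x m Hx Pm Em) as [B2 [N2 ->]].
    exists (B1 ++ B2). rewrite <- block_digits_app in Hz.
    split; [|apply Hz]. destruct B1; [contradiction|discriminate].
Qed.

(** * From continued fraction digits to letters *)

Definition letter_run (x : R) (i : nat) : list mat2 :=
  repeat (if Nat.even i then mat_T else mat_V) (Z.to_nat (cf_digit x i)).

Lemma cf_word_add x m n : cf_word x (m + n) =
  cf_word x m ++ flat_map (letter_run x) (seq m n).
Proof. unfold cf_word. rewrite seq_app, flat_map_app. reflexivity. Qed.

(** Parity is counted from the start of the run instead of from the absolute position [s]; a block
    consumes two digits, so parity is restored at each induction step. *)
Lemma letter_runs_blocks (g : nat -> list mat2) B s :
  (forall i, (i < length (block_digits B))%nat -> g (s + i)%nat =
    repeat (if Nat.even i then mat_T else mat_V) (Z.to_nat (nth i (block_digits B) 0%Z))) ->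
  flat_map g (seq s (length (block_digits B))) = map lmat (block_word B).
Proof.
  revert s. induction B as [|b B IH]; intros s H; [reflexivity|].
  assert (L : length (block_digits (b :: B)) = S (S (length (block_digits B))))
    by (destruct b; reflexivity).
  rewrite L. cbn [seq flat_map].
  assert (E0 := H 0%nat ltac:(lia)). assert (E1 := H 1%nat ltac:(lia)).
  rewrite Nat.add_0_r in E0. rewrite Nat.add_1_r in E1. rewrite E0, E1.
  rewrite (IH (S (S s))).
  - destruct b; reflexivity.
  - intros i Hi. replace (S (S s) + i)%nat with (s + S (S i))%nat by lia.
    rewrite H by lia. destruct b; reflexivity.
Qed.

Lemma cf_word_wpow B x k : cf_blocks B x ->
  cf_word x (k * length (block_digits B)) = map lmat (wpow k (block_word B)).
Proof.
  intros [HB Hd]. set (p := length (block_digits B)) in *.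
  assert (Hp : p = (2 * length B)%nat) by apply length_block_digits.
  assert (LB : (0 < length B)%nat) by (destruct B; [contradiction|simpl; lia]).
  induction k as [|k IH]; [reflexivity|].
  replace (S k * p)%nat with (k * p + p)%nat by lia.
  rewrite cf_word_add, IH, wpow_S_r, map_app. f_equal.
  apply letter_runs_blocks. intros i Hi. fold p in Hi. unfold letter_run. rewrite Hd. f_equal.
  (* The number of digits in a period is even, so every period starts with a T again. *)
  - replace (k * p + i)%nat with (i + 2 * (k * length B))%nat by lia.
    now rewrite Nat.even_add_mul_2.
  - do 2 f_equal. rewrite (Nat.add_comm _ i), Nat.Div0.mod_add. now apply Nat.mod_small.
Qed.

Lemma cf_blocks_digit_pos B x n : cf_blocks B x -> (1 <= cf_digit x n)%Z.
Proof.
  intros H. destruct (Nat.Even_or_Odd n) as [[i ->]|[i ->]];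
    destruct (cf_blocks_paired B x H i) as [b [E1 E2]]; [rewrite E1|rewrite E2]; destruct b; lia.
Qed.

Lemma cf_word_length B x n : cf_blocks B x -> (n <= length (cf_word x n))%nat.
Proof.
  intros H. induction n as [|n IH]; [lia|].
  replace (S n) with (n + 1)%nat by lia. rewrite cf_word_add, length_app. simpl.
  rewrite app_nil_r. unfold letter_run. rewrite repeat_length.
  pose proof (cf_blocks_digit_pos B x n H). lia.
Qed.

Lemma wpow_add m n L : wpow (m + n) L = wpow m L ++ wpow n L.
Proof. unfold wpow. rewrite repeat_app, concat_app. reflexivity. Qed.

Lemma length_wpow k L : length (wpow k L) = (k * length L)%nat.
Proof. induction k as [|k IH]; [reflexivity|]. rewrite wpow_S, length_app, IH. lia. Qed.

Lemma firstn_wpow L n : (0 < length L)%nat -> firstn n (wpow (S n) L) = prefix L n.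
Proof.
  intros HL. unfold prefix. set (q := (n / length L)%nat). set (r := (n mod length L)%nat).
  assert (En : n = (q * length L + r)%nat).
  { unfold q, r. rewrite Nat.mul_comm. apply Nat.div_mod_eq. }
  assert (Hr : (r < length L)%nat) by (apply Nat.mod_upper_bound; lia).
  (* Besides the [q] full copies at least one more remains, from which the last [r] letters are
     taken. *)
  replace (S n) with (q + S (n - q))%nat by nia.
  rewrite wpow_add, wpow_S. rewrite En at 1. rewrite <- (length_wpow q L).
  rewrite firstn_app_2. f_equal. rewrite firstn_app.
  replace (r - length L)%nat with 0%nat by lia. simpl. apply app_nil_r.
Qed.

Lemma cf_matrix_prefix B x n : cf_blocks B x ->
  cf_matrix x n = word_mat (prefix (block_word B) n).
Proof.
  intros H. unfold cf_matrix, word_mat. f_equal.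
  assert (LP : (0 < length (block_word B))%nat)
    by (apply mixed_length, block_word_mixed, H).
  rewrite <- firstn_wpow, <- firstn_map, <- (cf_word_wpow B x) by auto.
  assert (Lb : (1 <= length (block_digits B))%nat).
  { rewrite length_block_digits. destruct H as [H _]. destruct B; [contradiction|simpl; lia]. }
  (* The word of [S n] digits is an initial part of the word of [S n] periods and already has at
     least [n] letters, so truncation to [n] letters cannot tell them apart. *)
  replace (S n * length (block_digits B))%nat with
    (S n + (S n * length (block_digits B) - S n))%nat by nia.
  rewrite cf_word_add, firstn_app.
  pose proof (cf_word_length B x (S n) H).
  replace (n - length (cf_word x (S n)))%nat with 0%nat by lia.
  simpl (firstn 0 _). now rewrite app_nil_r.
Qed.

Lemma Lambda_blocks f tau0 B x : holomorphic_on_H f -> SL2Z_letters f -> real_nonneg_on_arc f ->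
  upper_half tau0 -> cf_blocks B x ->
  Lambda f tau0 x =
    Finite (Re (cycle_integral f tau0 (word_mat (block_word B))) / INR (length (block_word B))).
Proof.
  intros Hf Hl Hr Ht H. apply is_LimSup_seq_unique.
  eapply is_LimSup_seq_ext;
    [|apply (cycle_integral_LimSup f tau0 Hf Hl Hr Ht); apply block_word_mixed, H].
  intros n. cbv beta. now rewrite (cf_matrix_prefix B x n H).
Qed.

Theorem theorem1p8 :
  forall (f : C -> C) (tau0 : C),
    weakly_holomorphic_modular_function f ->
    (exists tau : C, upper_half tau /\ f tau <> RtoC 0) ->
    (forall t : R, PI / 3 <= t <= 2 * PI / 3 ->
       Im (f (cos t, sin t)) = 0 /\ 0 <= Re (f (cos t, sin t))) ->
    upper_half tau0 ->
    forall w : R, markov_irrationality w ->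
      Rbar_le (Lambda f tau0 psi) (Lambda f tau0 w) /\
      Rbar_le (Lambda f tau0 w) (Lambda f tau0 phi).
Proof.
  intros f tau0 [Hf [Hs _]] _ Hr Ht w [a [b Hw]].
  apply SL2Z_invariant_letters in Hs.
  destruct (markov_blocks a b w Hw) as [B HB].
  rewrite (Lambda_blocks f tau0 B w), (Lambda_blocks f tau0 _ psi Hf Hs Hr Ht cf_blocks_psi),
    (Lambda_blocks f tau0 _ phi Hf Hs Hr Ht cf_blocks_phi) by auto.
  exact (average_bounds f tau0 Hf Hs Hr Ht B (proj1 HB)).
Qed.
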